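(* Let $E$ and $F$ be real Banach lattices and let $T:E\to F$ be an order bounded operator. Suppose that one of the following holds: (i) $E$ has sequentially weakly continuous lattice operations; (ii) $F'$ has sequentially weakly continuous lattice operations; (iii) $T$ is positive and $F$ is discrete with order continuous norm. Then $T$ is an almost weak Dunford-Pettis operator if and only if $T$ is a weak Dunford-Pettis operator.
   Context: An operator means a bounded linear map. An operator $T:E\to F$ between Banach lattices is order bounded if it maps order bounded sets to order bounded sets, and positive if $T(E^+)\subset F^+$. $T$ is weak Dunford-Pettis (wDP) if $f_n(Tx_n)\to 0$ whenever $(x_n)$ is weakly null in $E$ and $(f_n)$ is weakly null in $F'$. $T$ is almost weak Dunford-Pettis (awDP) if $f_n(Tx_n)\to 0$ whenever $(x_n)\subset E$ is a disjoint weakly null sequence and $(f_n)\subset F'$ is a disjoint weakly null sequence (disjoint meaning $|x_n|\wedge|x_m|=0$ for $n\neq m$). A Banach lattice has sequentially weakly continuous lattice operations if $|x_n|\to 0$ weakly for every weakly null sequence $(x_n)$. A Banach lattice is discrete (atomic) if every nontrivial interval $[0,x]$ contains a discrete element, where $x>0$ is discrete if $u,v\in[0,x]$, $u\wedge v=0$ imply $u=0$ or $v=0$. The norm is order continuous if $x_\alpha\downarrow 0$ implies $\|x_\alpha\|\to 0$. *)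

(* Defs.v *)
From HB Require Import structures.
From mathcomp Require Import all_boot all_order all_algebra.
From mathcomp Require Import all_classical all_reals all_analysis.
Set Implicit Arguments. Unset Strict Implicit. Unset Printing Implicit Defensive.
Import Order.TTheory GRing.Theory Num.Theory.
Import numFieldNormedType.Exports.
Local Open Scope classical_set_scope.
Local Open Scope ring_scope.

Record banach_lattice_on (R : realType) (E : completeNormedModType R) :=
  BanachLattice {
  ble : E -> E -> Prop;
  bjoin : E -> E -> E;
  ble_refl : forall x, ble x x;
  ble_trans : forall x y z, ble x y -> ble y z -> ble x z;
  ble_anti : forall x y, ble x y -> ble y x -> x = y;
  ble_add : forall x y z, ble x y -> ble (x + z) (y + z);
  ble_scale : forall (a : R) x y, 0 <= a -> ble x y -> ble (a *: x) (a *: y);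
  bjoin_ubl : forall x y, ble x (bjoin x y);
  bjoin_ubr : forall x y, ble y (bjoin x y);
  bjoin_lub : forall x y z, ble x z -> ble y z -> ble (bjoin x y) z;
  bnorm_mono : forall x y, ble (bjoin x (- x)) (bjoin y (- y)) -> `|x| <= `|y|
}.

Section BL.
Variables (R : realType).

Definition bmeet (E : completeNormedModType R) (L : banach_lattice_on E)
  (x y : E) : E := - bjoin L (- x) (- y).
Definition labs (E : completeNormedModType R) (L : banach_lattice_on E)
  (x : E) : E := bjoin L x (- x).
Definition bpos (E : completeNormedModType R) (L : banach_lattice_on E)
  (x : E) : E := bjoin L x 0.

Definition is_linear_map (E F : normedModType R) (T : E -> F) :=
  forall (a : R) x y, T (a *: x + y) = a *: T x + T y.
Definition bounded_operator (E F : normedModType R) (T : E -> F) :=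
  is_linear_map T /\ exists C : R, forall x, `|T x| <= C * `|x|.

Definition in_dual (E : normedModType R) (f : E -> R) :=
  (forall (a : R) x y, f (a *: x + y) = a * f x + f y) /\
  exists C : R, forall x, `|f x| <= C * `|x|.

(* the bidual E'' : bounded linear functionals on E' (with the dual norm;
   "|phi f| <= C * M whenever M bounds f" is |phi f| <= C ||f||) *)
Definition in_bidual (E : normedModType R) (phi : (E -> R) -> R) :=
  (forall (a : R) f g, in_dual f -> in_dual g ->
     phi (fun y => a * f y + g y) = a * phi f + phi g) /\
  exists C : R, forall f (M : R), in_dual f -> 0 <= M ->
     (forall y, `|f y| <= M * `|y|) -> `|phi f| <= C * M.

Definition weakly_null (E : normedModType R) (x : nat -> E) :=
  forall f, in_dual f -> (fun n => f (x n)) @ \oo --> (0 : R).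

Definition dual_weakly_null (E : normedModType R) (f : nat -> E -> R) :=
  (forall n, in_dual (f n)) /\
  forall phi, in_bidual phi -> (fun n => phi (f n)) @ \oo --> (0 : R).

(* Riesz-Kantorovich modulus |f| of f in E':
   |f|(x) = sup{ |f y| : |y| <= x } for x >= 0, extended by |f|(x^+) - |f|(x^-) *)
Definition dual_abs_pos (E : completeNormedModType R) (L : banach_lattice_on E)
  (f : E -> R) (x : E) : R :=
  sup [set r | exists y, ble L (labs L y) x /\ r = `|f y|].
Definition dual_abs (E : completeNormedModType R) (L : banach_lattice_on E)
  (f : E -> R) : E -> R :=
  fun x => dual_abs_pos L f (bpos L x) - dual_abs_pos L f (bpos L (- x)).

(* disjointness in E': (|f| /\ |g|)(x) = inf{|f|(y) + |g|(x-y) : 0<=y<=x}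
   vanishes for all x >= 0 *)
Definition dual_disjoint (E : completeNormedModType R) (L : banach_lattice_on E)
  (f g : E -> R) :=
  forall x, ble L 0 x ->
    inf [set r | exists y, ble L 0 y /\ ble L y x /\
                   r = dual_abs L f y + dual_abs L g (x - y)] = 0.

Definition disjoint_seq (E : completeNormedModType R) (L : banach_lattice_on E)
  (x : nat -> E) :=
  forall n m, n <> m -> bmeet L (labs L (x n)) (labs L (x m)) = 0.
Definition dual_disjoint_seq (E : completeNormedModType R)
  (L : banach_lattice_on E) (f : nat -> E -> R) :=
  forall n m, n <> m -> dual_disjoint L (f n) (f m).

Definition swc_lattice_ops (E : completeNormedModType R)
  (L : banach_lattice_on E) :=
  forall x, weakly_null x -> weakly_null (fun n => labs L (x n)).
Definition dual_swc_lattice_ops (E : completeNormedModType R)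
  (L : banach_lattice_on E) :=
  forall f, dual_weakly_null f -> dual_weakly_null (fun n => dual_abs L (f n)).

Definition order_bounded (E F : completeNormedModType R)
  (LE : banach_lattice_on E) (LF : banach_lattice_on F) (T : E -> F) :=
  forall a b : E, exists c d : F, forall x,
    ble LE a x -> ble LE x b -> ble LF c (T x) /\ ble LF (T x) d.
Definition positive_op (E F : completeNormedModType R)
  (LE : banach_lattice_on E) (LF : banach_lattice_on F) (T : E -> F) :=
  forall x, ble LE 0 x -> ble LF 0 (T x).

Definition discrete_elt (E : completeNormedModType R) (L : banach_lattice_on E)
  (x : E) :=
  ble L 0 x /\ x <> 0 /\
  forall u v, ble L 0 u -> ble L u x -> ble L 0 v -> ble L v x ->
    bmeet L u v = 0 -> u = 0 \/ v = 0.
Definition discrete_lattice (E : completeNormedModType R)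
  (L : banach_lattice_on E) :=
  forall x, ble L 0 x -> x <> 0 ->
    exists d, ble L 0 d /\ ble L d x /\ discrete_elt L d.

Definition order_continuous_norm (E : completeNormedModType R)
  (L : banach_lattice_on E) :=
  forall (I : Type) (leI : I -> I -> Prop) (x : I -> E),
    (exists i : I, True) ->
    (forall i, leI i i) ->
    (forall i j k, leI i j -> leI j k -> leI i k) ->
    (forall i j, exists k, leI i k /\ leI j k) ->
    (forall i j, leI i j -> ble L (x j) (x i)) ->
    (forall i, ble L 0 (x i)) ->
    (forall z, (forall i, ble L z (x i)) -> ble L z 0) ->
    forall eps : R, 0 < eps ->
      exists i0, forall i, leI i0 i -> `|x i| < eps.

Definition wDP (E F : normedModType R) (T : E -> F) :=
  forall (x : nat -> E) (f : nat -> F -> R),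
    weakly_null x -> dual_weakly_null f ->
    (fun n => f n (T (x n))) @ \oo --> (0 : R).
Definition awDP (E F : completeNormedModType R)
  (LE : banach_lattice_on E) (LF : banach_lattice_on F) (T : E -> F) :=
  forall (x : nat -> E) (f : nat -> F -> R),
    disjoint_seq LE x -> weakly_null x ->
    dual_disjoint_seq LF f -> dual_weakly_null f ->
    (fun n => f n (T (x n))) @ \oo --> (0 : R).

End BL.

(* Main.v *)
Require Import Defs.
From HB Require Import structures.
From mathcomp Require Import all_boot all_order all_algebra.
From mathcomp Require Import ring lra.
From mathcomp Require Import all_classical all_reals all_analysis.
Set Implicit Arguments. Unset Strict Implicit. Unset Printing Implicit Defensive.
Import Order.TTheory GRing.Theory Num.Theory.
Import numFieldNormedType.Exports.
Local Open Scope classical_set_scope.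
Local Open Scope ring_scope.

(* Two facts about Banach lattices are combined.

   (A) If [x_n] is weakly null, [|y_n| <= |x_n|] and the [y_n] are disjoint, then
   [y_n] is weakly null: for [phi >= 0] the components of [phi] carried by the
   [y_n] have sums dominated by [phi], and a gliding hump argument (Schur's
   theorem in l^1) applies.

   (B) If [x_n] is bounded and [rho_n] are positive functionals tending to 0
   pointwise, then along a subsequence [|x_n|] is a disjoint sequence up to a
   remainder [r_n] with [rho_n r_n -> 0].

   By (A) and (B), [a_n x_n -> 0] can be tested on disjoint weakly null sequences
   whenever [|a_n| -> 0] pointwise on the cone.  Let T be almost weak
   Dunford-Pettis.  Testing in E, with [a_n = f_n o T], gives [f_n (T x_n) -> 0]
   for disjoint weakly null [f_n]: then [|f_n|] is weakly null by (A).
   Testing in F', with [a_n g = g (T x_n)], extends this to all weakly null [f_n]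
   when [x_n >= 0]: every [g >= 0] satisfies [g |T x| <= phi x] on the cone of E
   for some functional [phi], because T is order bounded.  This settles (i).
   In cases (ii) and (iii), [|f_n| -> 0] pointwise on the cone of F for every
   weakly null [f_n] (in (iii) because order intervals are almost contained in
   bounded finite-dimensional boxes), so one more test in E reduces to disjoint
   [x_n], whose positive and negative parts are weakly null by (A). *)

(** * Linear identities in modules *)

Section ModuleExpressions.
Variables (R : realType) (V : lmodType R).

(** Syntax for linear combinations of atoms. Two expressions agree as soon as their coefficients
    agree at every atom, so an identity in a module becomes finitely many identities in [R], left to
    [ring], [field] or [lra]. *)
Inductive mexp :=
  | MVar of nat | MZero | MAdd of mexp & mexp | MOpp of mexp
  | MScale of R & mexp.

Fixpoint mev (env : seq V) (e : mexp) : V :=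
  match e with
  | MVar n => nth 0 env n
  | MZero => 0
  | MAdd a b => mev env a + mev env b
  | MOpp a => - mev env a
  | MScale c a => c *: mev env a
  end.

Fixpoint mcoef (e : mexp) (i : nat) : R :=
  match e with
  | MVar n => if eqn n i then 1 else 0
  | MZero => 0
  | MAdd a b => mcoef a i + mcoef b i
  | MOpp a => - mcoef a i
  | MScale c a => c * mcoef a i
  end.

Fixpoint same_coefs (n : nat) (e1 e2 : mexp) : Prop :=
  match n with
  | 0 => True
  | n'.+1 => mcoef e1 n' = mcoef e2 n' /\ same_coefs n' e1 e2
  end.

Lemma mevE (env : seq V) e :
  mev env e = \sum_(i < size env) mcoef e i *: env`_i.
Proof.
elim: e => [n||a IHa b IHb|a IHa|c a IHa] /=.
- case: (ltnP n (size env)) => [nlt|nge].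
    rewrite (bigD1 (Ordinal nlt)) //= ?eqnE eqxx scale1r big1 ?addr0 // => i.
    move=> /eqP ine; rewrite ?eqnE; case: eqP => [ni|_]; last by rewrite scale0r.
    by case: ine; apply: val_inj.
  rewrite nth_default // big1 // => i _; rewrite ?eqnE; case: eqP => [ni|_].
    by move: (ltn_ord i); rewrite -ni ltnNge nge.
  by rewrite scale0r.
- by rewrite big1 // => i _; rewrite scale0r.
- by rewrite IHa IHb -big_split; apply: eq_bigr => i _; rewrite scalerDl.
- by rewrite IHa -sumrN; apply: eq_bigr => i _; rewrite scaleNr.
- by rewrite IHa scaler_sumr; apply: eq_bigr => i _; rewrite scalerA.
Qed.

Lemma mev_eq (env : seq V) e1 e2 :
  same_coefs (size env) e1 e2 -> mev env e1 = mev env e2.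
Proof.
move=> h; rewrite !mevE; apply: eq_bigr => i _; congr (_ *: _).
elim: (size env) i h => [|n IHn] [i ilt] //= [h1 h2].
move: ilt; rewrite ltnS leq_eqVlt => /orP[/eqP -> //|ilt].
exact: (IHn (Ordinal ilt)).
Qed.

End ModuleExpressions.

Ltac mod_find x l :=
  lazymatch l with
  | x :: _ => constr:(0%N)
  | _ :: ?l' => let n := mod_find x l' in constr:(n.+1)
  end.
Ltac mod_mem x l :=
  lazymatch l with
  | nil => constr:(false)
  | x :: _ => constr:(true)
  | _ :: ?l' => mod_mem x l'
  end.
Ltac mod_atoms t l :=
  lazymatch t with
  | @GRing.add _ ?a ?b => let l1 := mod_atoms a l in mod_atoms b l1
  | @GRing.opp _ ?a => mod_atoms a l
  | @GRing.scale _ _ ?c ?a => mod_atoms a l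
  | @GRing.zero _ => constr:(l)
  | _ => lazymatch mod_mem t l with
         | true => constr:(l)
         | false => constr:(t :: l)
         end
  end.
Ltac mod_reify R t l :=
  lazymatch t with
  | @GRing.add _ ?a ?b =>
      let x := mod_reify R a l in let y := mod_reify R b l in
      constr:(@MAdd R x y)
  | @GRing.opp _ ?a => let x := mod_reify R a l in constr:(@MOpp R x)
  | @GRing.scale _ _ ?c ?a => let x := mod_reify R a l in constr:(@MScale R c x)
  | @GRing.zero _ => constr:(@MZero R)
  | _ => let n := mod_find t l in constr:(@MVar R n)
  end.
Ltac lmod_of R V t1 t2 :=
  let l0 := constr:(@nil (GRing.Lmodule.sort V)) in
  let l1 := mod_atoms t1 l0 in
  let l := mod_atoms t2 l1 in
  let e1 := mod_reify R t1 l in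
  let e2 := mod_reify R t2 l in
  refine (@mev_eq R V l e1 e2 _);
  cbn [same_coefs mcoef size eqn];
  repeat split; first [done | ring | field | lra].

(** * Real null sequences and subsequences *)

Section Null.
Variable R : realType.
Implicit Types u v : nat -> R.

Definition null u := forall e : R, 0 < e -> exists N, forall n, (N <= n)%N -> `|u n| <= e.

Lemma nullP u : null u <-> u @ \oo --> (0 : R).
Proof.
split.
  move=> h; apply/cvgrPdist_le => e e0; have [N hN] := h e e0.
  by exists N => // n /= nN; rewrite sub0r normrN; apply: hN.
move=> /cvgrPdist_le h e e0; have [N _ hN] := h e e0.
by exists N => n nN; have := hN n nN; rewrite sub0r normrN.
Qed.

Lemma null0 : null (fun=> 0).
Proof. by move=> e e0; exists 0%N => n _; rewrite normr0 ltW. Qed.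

Lemma nullD u v : null u -> null v -> null (fun n => u n + v n).
Proof.
move=> hu hv e e0; have e2 : 0 < e / 2 by lra.
have [N hN] := hu _ e2; have [M hM] := hv _ e2.
exists (maxn N M) => n; rewrite geq_max => /andP[nN nM].
have := hN n nN; have := hM n nM; have := ler_normD (u n) (v n); lra.
Qed.

Lemma nullZ a u : null u -> null (fun n => a * u n).
Proof.
move=> hu e e0; have [N hN] := hu (e / (`|a| + 1)) ltac:(by rewrite divr_gt0 // ltr_wpDl).
exists N => n /hN; rewrite ler_pdivlMr ?ltr_wpDl // normrM => h.
by apply: le_trans h; rewrite mulrC ler_wpM2l // lerDl.
Qed.

Lemma null_le u v : null v -> (forall n, `|u n| <= v n) -> null u.
Proof.
move=> hv h e e0; have [N hN] := hv e e0; exists N => n nN.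
by apply: le_trans (h n) _; apply: le_trans (ler_norm _) (hN n nN).
Qed.

Definition str_incr (s : nat -> nat) := forall n, (s n < s n.+1)%N.

Lemma str_incr_lt s i j : str_incr s -> (i < j)%N -> (s i < s j)%N.
Proof.
move=> hs; elim: j => // j IHj; rewrite ltnS leq_eqVlt => /orP[/eqP->|/IHj h] //.
exact: ltn_trans h (hs j).
Qed.

Lemma str_incr_inj s i j : str_incr s -> i <> j -> s i <> s j.
Proof.
move=> hs ij; case: (ltngtP i j) => // h.
  by have := str_incr_lt hs h; rewrite ltn_neqAle => /andP[/eqP].
by have := str_incr_lt hs h; rewrite ltn_neqAle eq_sym => /andP[/eqP].
Qed.

Lemma str_incr_ge s n : str_incr s -> (n <= s n)%N.
Proof. by move=> hs; elim: n => // n IHn; apply: leq_ltn_trans IHn (hs n). Qed.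

Lemma null_subseq u s : str_incr s -> null u -> null (fun n => u (s n)).
Proof.
move=> hs hu e e0; have [N hN] := hu e e0; exists N => n nN.
by apply: hN; apply: leq_trans nN (str_incr_ge n hs).
Qed.

Lemma subseq_of_frequently (P : nat -> Prop) :
  (forall N, exists2 n, (N <= n)%N & P n) ->
  exists2 s, str_incr s & forall n, P (s n).
Proof.
move=> h; have [g hg] : {g : nat -> nat & forall N, (N <= g N)%N /\ P (g N)}.
  apply: (@choice _ _ (fun N n => (N <= n)%N /\ P n)) => N.
  by have [n ? ?] := h N; exists n.
exists (fix s n := if n is m.+1 then g (s m).+1 else g 0%N) => [n|[|n]] /=.
- exact: (hg _).1.
- exact: (hg _).2.
- exact: (hg _).2.
Qed.

(** If [u] is not null, some [e > 0] is exceeded along a subsequence, and no further subsequence of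
    that one can be null. *)
Lemma null_subsub u :
  (forall s, str_incr s ->
     exists2 t, str_incr t & null (fun n => u (s (t n)))) -> null u.
Proof.
move=> h; apply: contrapT => /existsNP[e /not_implyP[e0 /forallNP hN]].
have [s hs us] : exists2 s, str_incr s & forall n, e < `|u (s n)|.
  apply: (@subseq_of_frequently (fun n => e < `|u n|)) => N.
  have /existsNP[n /not_implyP[nN /negP]] := hN N.
  by rewrite -ltNge => hn; exists n.
have [t ht /(_ e e0)[N /(_ N (leqnn N))]] := h s hs.
by rewrite leNgt us.
Qed.

Lemma null_geom (a q : R) : 0 <= q < 1 -> null (fun n => a * q ^+ n).
Proof.
move=> /andP[q0 q1]; apply: nullZ; apply/nullP; apply: cvg_expr.
by rewrite ger0_norm.
Qed.

Lemma le_null_geom (a b c q : R) : 0 <= q < 1 ->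
  (forall n, a <= b + c * q ^+ n) -> a <= b.
Proof.
move=> hq h; apply/ler_addgt0Pr => e e0.
have [N /(_ N (leqnn N)) hN] := null_geom c hq e0.
by apply: le_trans (h N) _; rewrite lerD2l; apply: le_trans (ler_norm _) hN.
Qed.

Lemma archi_le0 (a b : R) : (forall n : nat, n%:R * a <= b) -> a <= 0.
Proof.
move=> h; rewrite leNgt; apply/negP => a0.
have := le_lt_trans (ler_norm _) (archi_boundP (normr_ge0 (b / a))).
rewrite ltr_pdivrMr // => h1; have h2 := h (Num.bound `|b / a|).
by move: (lt_le_trans h1 h2); rewrite ltxx.
Qed.

End Null.

(** * Complete normed vector lattices *)

(** One structure for a Banach lattice and for its dual, so that every result below can be used in
    both. Completeness is stated for sequences whose increments decay like [4^-n], with an explicit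
    rate for the limit. *)
Record nlat (R : realType) (V : lmodType R) := NLat {
  rle : V -> V -> Prop;
  rjoin : V -> V -> V;
  (* [nbd x M] stands for "the norm of x is at most M" *)
  nbd : V -> R -> Prop;
  rle_refl : forall x, rle x x;
  rle_trans : forall x y z, rle x y -> rle y z -> rle x z;
  rle_anti : forall x y, rle x y -> rle y x -> x = y;
  rle_add : forall x y z, rle x y -> rle (x + z) (y + z);
  rle_scale : forall (a : R) x y, 0 <= a -> rle x y -> rle (a *: x) (a *: y);
  rjoin_ubl : forall x y, rle x (rjoin x y);
  rjoin_ubr : forall x y, rle y (rjoin x y);
  rjoin_lub : forall x y z, rle x z -> rle y z -> rle (rjoin x y) z;
  nbd_ex : forall x, exists M, nbd x M;
  nbd_ge0 : forall x M, nbd x M -> 0 <= M;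
  nbd_le : forall x M M', nbd x M -> M <= M' -> nbd x M';
  nbdZ : forall (a : R) x M, nbd x M -> nbd (a *: x) (`|a| * M);
  nbdD : forall x y M M', nbd x M -> nbd y M' -> nbd (x + y) (M + M');
  nbd_sep : forall x, (forall e, 0 < e -> nbd x e) -> x = 0;
  nbd_solid : forall x y M,
    rle (rjoin x (- x)) (rjoin y (- y)) -> nbd y M -> nbd x M;
  nbd_complete : forall x : nat -> V,
    (forall n, nbd (x n.+1 - x n) (4^-1 ^+ n)) ->
    exists y, forall n, nbd (y - x n) (2 * 4^-1 ^+ n)
}.

Section Lattice.
Variables (R : realType) (V : lmodType R) (L : nlat V).
Implicit Types (x y z a b c : V).

Local Notation "x <<= y" := (rle L x y) (at level 70, no associativity).
Local Notation join := (rjoin L).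

Local Ltac mring := lazymatch goal with |- ?a = ?b => lmod_of R V a b end.

Definition rmeet x y : V := - join (- x) (- y).
Definition rabs x : V := join x (- x).
Definition rpos x : V := join x 0.

Lemma rle_subl x y : x <<= y <-> 0 <<= y - x.
Proof.
split=> h; first by have := rle_add (- x) h; rewrite subrr.
by have := rle_add x h; rewrite add0r subrK.
Qed.

Lemma rle_eq x y : x = y -> x <<= y.
Proof. by move=> ->; apply: rle_refl. Qed.

Lemma radd_ge0 x y : 0 <<= x -> 0 <<= y -> 0 <<= x + y.
Proof.
move=> hx hy; apply: rle_trans hx _; have := rle_add x hy.
by rewrite add0r addrC.
Qed.

(** This lemma and its variants reduce an order inequality to a linear identity: [y - x] is written
    as a sum of differences known to be nonnegative. *)
Lemma rle_by1 a b x y : a <<= b -> y - x = b - a -> x <<= y.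
Proof. by move=> /rle_subl h e; apply/rle_subl; rewrite e. Qed.

Lemma rle_by2 a b c d x y : a <<= b -> c <<= d ->
  y - x = (b - a) + (d - c) -> x <<= y.
Proof.
move=> /rle_subl h /rle_subl h' e; apply/rle_subl; rewrite e.
exact: radd_ge0.
Qed.

Lemma rle_by3 a b c d a' b' x y : a <<= b -> c <<= d -> a' <<= b' ->
  y - x = (b - a) + (d - c) + (b' - a') -> x <<= y.
Proof.
move=> /rle_subl h /rle_subl h' /rle_subl h'' e; apply/rle_subl; rewrite e.
by apply: radd_ge0 => //; apply: radd_ge0.
Qed.

Lemma rleD a b c d : a <<= b -> c <<= d -> a + c <<= b + d.
Proof. by move=> h1 h2; apply: (rle_by2 h1 h2); mring. Qed.

Lemma rleN2 x y : x <<= y -> - y <<= - x.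
Proof. by move=> h; apply: (rle_by1 h); mring. Qed.

Lemma rscale_ge0 (t : R) x : 0 <= t -> 0 <<= x -> 0 <<= t *: x.
Proof. by move=> t0 h; have := rle_scale t0 h; rewrite scaler0. Qed.

Lemma rscale_le (s t : R) x : s <= t -> 0 <<= x -> s *: x <<= t *: x.
Proof.
move=> st x0; have := rscale_ge0 (t := t - s) ltac:(by rewrite subr_ge0) x0.
by move=> h; apply: (rle_by1 h); mring.
Qed.

Lemma rjoinC x y : join x y = join y x.
Proof.
by apply: (@rle_anti _ _ L); apply: rjoin_lub; (exact: rjoin_ubl || exact: rjoin_ubr).
Qed.

Lemma rjoinD x y z : join (x + z) (y + z) = join x y + z.
Proof.
apply: (@rle_anti _ _ L).
  by apply: rjoin_lub; apply: rle_add; [apply: rjoin_ubl|apply: rjoin_ubr].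
suff h : join x y <<= join (x + z) (y + z) - z by apply: (rle_by1 h); mring.
apply: rjoin_lub.
  by apply: (rle_by1 (rjoin_ubl L (x + z) (y + z))); mring.
by apply: (rle_by1 (rjoin_ubr L (x + z) (y + z))); mring.
Qed.

Lemma rmeet_lbl x y : rmeet x y <<= x.
Proof. by apply: (rle_by1 (rjoin_ubl L (- x) (- y))); rewrite /rmeet; mring. Qed.

Lemma rmeet_lbr x y : rmeet x y <<= y.
Proof. by apply: (rle_by1 (rjoin_ubr L (- x) (- y))); rewrite /rmeet; mring. Qed.

Lemma rmeet_glb x y z : z <<= x -> z <<= y -> z <<= rmeet x y.
Proof.
move=> /rleN2 h1 /rleN2 h2; apply: (rle_by1 (rjoin_lub h1 h2)).
by rewrite /rmeet; mring.
Qed.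

Lemma rmeetC x y : rmeet x y = rmeet y x.
Proof. by rewrite /rmeet rjoinC. Qed.

(** Translating [join (- x) (- y)] by [x + y] turns it into [join y x]. *)
Lemma rjoin_meet x y : join x y + rmeet x y = x + y.
Proof.
have := rjoinD (- x) (- y) (x + y).
rewrite (_ : - x + _ = y); last by mring.
rewrite (_ : - y + _ = x); last by mring.
rewrite rjoinC => ->; rewrite /rmeet; mring.
Qed.

Lemma rmeet_ge0 x y : 0 <<= x -> 0 <<= y -> 0 <<= rmeet x y.
Proof. exact: rmeet_glb. Qed.

Lemma rmeet_le x y x' y' : x <<= x' -> y <<= y' -> rmeet x y <<= rmeet x' y'.
Proof.
move=> hx hy; apply: rmeet_glb; first exact: rle_trans (rmeet_lbl _ _) hx.
exact: rle_trans (rmeet_lbr _ _) hy.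
Qed.

Lemma rmeet_idl x y : x <<= y -> rmeet x y = x.
Proof.
move=> h; apply: (@rle_anti _ _ L); first exact: rmeet_lbl.
by apply: rmeet_glb => //; apply: rle_refl.
Qed.

Lemma rpos_ge0 x : 0 <<= rpos x. Proof. exact: rjoin_ubr. Qed.
Lemma rpos_ge x : x <<= rpos x. Proof. exact: rjoin_ubl. Qed.

Lemma rpos_le x y : x <<= y -> rpos x <<= rpos y.
Proof.
move=> h; apply: rjoin_lub; last exact: rpos_ge0.
exact: rle_trans h (rpos_ge _).
Qed.

Lemma rposN x : rpos (- x) = rpos x - x.
Proof.
rewrite /rpos -(rjoinD x 0 (- x)) subrr add0r.
exact: rjoinC.
Qed.

Lemma rposB x : x = rpos x - rpos (- x).
Proof. by rewrite rposN; mring. Qed.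

Lemma rabsE x : rabs x = rpos x + rpos (- x).
Proof.
have h := rjoinD (x + x) 0 (- x).
rewrite (_ : x + x - x = x) in h; last by mring.
rewrite add0r in h; rewrite /rabs h rposN.
suff -> : join (x + x) 0 = rpos x + rpos x by mring.
(* Half of [rpos (x + x)] dominates both [x] and [0], hence [rpos x]; this gives the nontrivial
   inequality. *)
have h2 : rpos x + rpos x = rpos (x + x).
  apply: (@rle_anti _ _ L); last first.
    apply: rjoin_lub; first exact: rleD (rpos_ge _) (rpos_ge _).
    exact: radd_ge0 (rpos_ge0 _) (rpos_ge0 _).
  suff h3 : rpos x <<= 2^-1 *: rpos (x + x).
    by apply: (rle_by2 h3 h3); mring.
  apply: rjoin_lub; last by apply: rscale_ge0 (rpos_ge0 _); rewrite invr_ge0.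
  have := @rle_scale _ _ L 2^-1 _ _ ltac:(by rewrite invr_ge0) (rpos_ge (x + x)).
  by move=> h4; apply: (rle_by1 h4); mring.
by rewrite h2.
Qed.

Lemma rabs_ge0 x : 0 <<= rabs x.
Proof. by rewrite rabsE; apply: radd_ge0 (rpos_ge0 _) (rpos_ge0 _). Qed.

Lemma rabs_ge x : x <<= rabs x. Proof. exact: rjoin_ubl. Qed.
Lemma rabs_geN x : - x <<= rabs x. Proof. exact: rjoin_ubr. Qed.

Lemma rabs_leP x a : rabs x <<= a <-> x <<= a /\ - x <<= a.
Proof.
split=> [h|[h1 h2]]; last exact: rjoin_lub.
by split; [exact: rle_trans (rabs_ge _) h|exact: rle_trans (rabs_geN _) h].
Qed.

Lemma rabs_id x : 0 <<= x -> rabs x = x.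
Proof.
move=> h; apply: (@rle_anti _ _ L); last exact: rabs_ge.
apply/rabs_leP; split; first exact: rle_refl.
by apply: (rle_by2 h h); mring.
Qed.

Lemma rabsK x : rabs (rabs x) = rabs x.
Proof. exact: rabs_id (rabs_ge0 x). Qed.

Lemma rabsN x : rabs (- x) = rabs x.
Proof. by rewrite /rabs opprK rjoinC. Qed.

Lemma rabs0 : rabs 0 = 0.
Proof. by apply: rabs_id; apply: rle_refl. Qed.

Lemma rabsD x y : rabs (x + y) <<= rabs x + rabs y.
Proof.
apply/rabs_leP; split; first exact: rleD (rabs_ge _) (rabs_ge _).
by apply: (rle_by2 (rabs_geN x) (rabs_geN y)); mring.
Qed.

Lemma rpos_le_abs x : rpos x <<= rabs x.
Proof. by rewrite rabsE; apply: (rle_by1 (rpos_ge0 (- x))); mring. Qed.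

Lemma rneg_le_abs x : rpos (- x) <<= rabs x.
Proof. by rewrite -rabsN; apply: rpos_le_abs. Qed.

(** Let [m] be the left side. Then [m - a] lies below [b] and [c], so [m - rmeet b c] lies below
    [a]; it also lies below [c]. *)
Lemma rmeet_addl a b c : 0 <<= a -> 0 <<= b -> 0 <<= c ->
  rmeet (a + b) c <<= rmeet a c + rmeet b c.
Proof.
move=> a0 b0 c0; have ml := rmeet_lbl (a + b) c; have mr := rmeet_lbr (a + b) c.
set m := rmeet (a + b) c in ml mr *.
have h1 : m - rmeet b c <<= a.
  have h : m - a <<= rmeet b c.
    apply: rmeet_glb; first by apply: (rle_by1 ml); mring.
    by apply: (rle_by2 mr a0); mring.
  by apply: (rle_by1 h); mring.
have h2 : m - rmeet b c <<= c.
  by apply: (rle_by2 mr (rmeet_ge0 b0 c0)); mring.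
by apply: (rle_by1 (rmeet_glb h1 h2)); mring.
Qed.

Lemma riesz_dec y a b : 0 <<= y -> y <<= a + b -> 0 <<= a -> 0 <<= b ->
  exists y1 y2, [/\ y = y1 + y2, 0 <<= y1, y1 <<= a, 0 <<= y2 & y2 <<= b].
Proof.
move=> y0 yab a0 b0; exists (rmeet y a), (y - rmeet y a); split.
- by mring.
- exact: rmeet_ge0.
- exact: rmeet_lbr.
- by apply: (rle_by1 (rmeet_lbl y a)); mring.
- have h : y - b <<= rmeet y a.
    by apply: rmeet_glb; [apply: (rle_by1 b0)|apply: (rle_by1 yab)]; mring.
  by apply: (rle_by1 h); mring.
Qed.

(** The first summand is [y] truncated to the interval from [- a] to [a]. *)
Lemma riesz_dec_abs y a b : rabs y <<= a + b -> 0 <<= a -> 0 <<= b ->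
  exists y1 y2, [/\ y = y1 + y2, rabs y1 <<= a & rabs y2 <<= b].
Proof.
move=> /rabs_leP[h1 h2] a0 b0.
have na : - a <<= a by apply: (rle_by2 a0 a0); mring.
set y1 := join (rmeet y a) (- a).
have y1a : y1 <<= a by apply: rjoin_lub => //; apply: rmeet_lbr.
have y1na : - a <<= y1 by apply: rjoin_ubr.
exists y1, (y - y1); split; first by mring.
  by apply/rabs_leP; split=> //; apply: (rle_by1 y1na); mring.
apply/rabs_leP; split.
  have h : y - b <<= y1.
    apply: rle_trans (rjoin_ubl _ _ _); apply: rmeet_glb.
      by apply: (rle_by1 b0); mring.
    by apply: (rle_by1 h1); mring.
  by apply: (rle_by1 h); mring.
have h : y1 <<= y + b.
  apply: rjoin_lub; last by apply: (rle_by1 h2); mring.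
  by apply: (rle_by2 (rmeet_lbl y a) b0); mring.
by apply: (rle_by1 h); mring.
Qed.

Lemma rdisj_le a b a' b' : rmeet a b = 0 -> 0 <<= a' -> 0 <<= b' ->
  a' <<= a -> b' <<= b -> rmeet a' b' = 0.
Proof.
move=> h a0 b0 ha hb; apply: (@rle_anti _ _ L); last exact: rmeet_ge0.
by rewrite -h; apply: rmeet_le.
Qed.

Lemma rdisjD a b c : 0 <<= a -> 0 <<= b -> 0 <<= c ->
  rmeet a c = 0 -> rmeet b c = 0 -> rmeet (a + b) c = 0.
Proof.
move=> a0 b0 c0 h1 h2; apply: (@rle_anti _ _ L).
  by have := rmeet_addl a0 b0 c0; rewrite h1 h2 addr0.
by apply: rmeet_ge0 => //; apply: radd_ge0.
Qed.

Lemma rdisj_nat a c k : 0 <<= a -> 0 <<= c -> rmeet a c = 0 ->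
  rmeet (k%:R *: a) c = 0.
Proof.
move=> a0 c0 h; elim: k => [|k IHk]; first by rewrite scale0r rmeet_idl.
rewrite -natr1 scalerDl scale1r; apply: rdisjD => //.
by apply: rscale_ge0.
Qed.

Lemma rdisj_scale (t : R) a c : 0 <= t -> 0 <<= a -> 0 <<= c ->
  rmeet a c = 0 -> rmeet (t *: a) c = 0.
Proof.
move=> t0 a0 c0 h; apply: (rdisj_le (rdisj_nat (Num.bound t) a0 c0 h)) => //.
- exact: rscale_ge0.
- by apply: rscale_le => //; apply/ltW/archi_boundP.
- exact: rle_refl.
Qed.

(** The join of the two parts is [rabs x], which is also their sum, so [rjoin_meet] leaves nothing
    for the meet. *)
Lemma rpos_disj x : rmeet (rpos x) (rpos (- x)) = 0.
Proof.
have := rjoin_meet (rpos x) (rpos (- x)); rewrite -rabsE.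
suff -> : join (rpos x) (rpos (- x)) = rabs x.
  by move=> /(congr1 (fun v => v - rabs x)); rewrite addrAC subrr add0r.
apply: (@rle_anti _ _ L).
  by apply: rjoin_lub; [apply: rpos_le_abs|apply: rneg_le_abs].
apply/rabs_leP; split.
  exact: rle_trans (rpos_ge _) (rjoin_ubl _ _ _).
exact: rle_trans (rpos_ge _) (rjoin_ubr _ _ _).
Qed.

Lemma rsum_recr (x : nat -> V) n :
  \sum_(i < n.+1) x i = \sum_(i < n) x i + x n.
Proof. exact: big_ord_recr. Qed.

Lemma rsum_ge0 (x : nat -> V) n : (forall i, 0 <<= x i) -> 0 <<= \sum_(i < n) x i.
Proof.
move=> h; elim: n => [|n IHn]; first by rewrite big_ord0; apply: rle_refl.
by rewrite rsum_recr; apply: radd_ge0.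
Qed.

Lemma rsum_ge (x : nat -> V) n i : (forall i, 0 <<= x i) -> (i < n)%N ->
  x i <<= \sum_(i < n) x i.
Proof.
move=> h; elim: n => // n IHn; rewrite rsum_recr ltnS leq_eqVlt.
move=> /orP[/eqP ->|/IHn {}IHn].
  by apply: (rle_by1 (rsum_ge0 n h)); mring.
by apply: (rle_by2 IHn (h n)); mring.
Qed.

(** A partial sum is disjoint from the next term, so adding that term is the same as joining with
    it. *)
Lemma rsum_disj (x : nat -> V) u n : (forall i, 0 <<= x i) ->
  (forall i, x i <<= u) -> 0 <<= u ->
  (forall i j, i <> j -> rmeet (x i) (x j) = 0) ->
  \sum_(i < n) x i <<= u.
Proof.
move=> x0 xu u0 hd; elim: n => [|n IHn]; first by rewrite big_ord0.
have hn : rmeet (\sum_(i < n) x i) (x n) = 0.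
  have : forall m, (m <= n)%N -> rmeet (\sum_(i < m) x i) (x n) = 0; last exact.
  elim=> [_|m IHm mn]; first by rewrite big_ord0 rmeet_idl.
  rewrite rsum_recr; apply: rdisjD => //; last 2 first.
  - exact/IHm/ltnW.
  - by apply: hd => e; move: mn; rewrite e ltnn.
  - exact: rsum_ge0.
rewrite rsum_recr -(rjoin_meet _ (x n)) hn addr0.
exact: rjoin_lub.
Qed.

Lemma nbd_abs x M : nbd L x M -> nbd L (rabs x) M.
Proof.
by apply: nbd_solid; rewrite -/(rabs x) -/(rabs (rabs x)) rabsK; apply: rle_refl.
Qed.

Lemma nbd_mono x y M : rabs x <<= rabs y -> nbd L y M -> nbd L x M.
Proof. exact: nbd_solid. Qed.

Lemma nbd0 M : 0 <= M -> nbd L 0 M.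
Proof.
have [K hK] := nbd_ex L 0; move=> M0; have := nbdZ 0 hK.
by rewrite scaler0 normr0 mul0r => /nbd_le; apply.
Qed.

(** The cone is closed: since [y n] is nonnegative, the negative part of [x] is dominated by
    [rabs (x - y n)] and so has arbitrarily small norm. *)
Lemma rle_lim x (M : nat -> R) (y : nat -> V) : null M ->
  (forall n, nbd L (x - y n) (M n)) -> (forall n, 0 <<= y n) -> 0 <<= x.
Proof.
move=> hM hb hy; suff h : rpos (- x) = 0.
  by rewrite (rposB x) h subr0; apply: rpos_ge0.
apply: (@nbd_sep _ _ L) => e e0; have [N /(_ N (leqnn N)) hN] := hM e e0.
have hx := hb N; apply: nbd_le (le_trans (ler_norm _) hN).
apply: nbd_mono hx; rewrite rabs_id; last exact: rpos_ge0.
apply: rjoin_lub; last exact: rabs_ge0.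
by apply: (rle_by2 (rabs_geN (x - y N)) (hy N)); mring.
Qed.

(** The common bound [w] is the sum of the series of moduli, which completeness provides. *)
Lemma nbd_dominated (x : nat -> V) : (forall n, nbd L (x n) (4^-1 ^+ n)) ->
  exists w, 0 <<= w /\ forall n, rabs (x n) <<= w.
Proof.
move=> h; pose s n := \sum_(i < n) rabs (x i).
have [n|w hw] := @nbd_complete _ _ L s.
  by rewrite /s (rsum_recr (fun i => rabs (x i))) addrC addKr; apply: nbd_abs.
have key i : rabs (x i) <<= w.
  apply/rle_subl; apply: (@rle_lim _ (fun n => 2 * 4^-1 ^+ (i.+1 + n))
    (fun n => s (i.+1 + n)%N - rabs (x i))).
  - move=> e e0.
    have [N hN] := @null_geom R 2 4^-1 ltac:(by apply/andP; split; lra) e e0.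
    exists N => n nN; apply: hN; exact: leq_trans nN (leq_addl _ _).
  - move=> n; have := hw (i.+1 + n)%N; congr (nbd L _ _).
    by mring.
  - move=> n; apply: (rle_subl _ _).1; apply: (@rsum_ge (fun i => rabs (x i)));
      last by rewrite ltn_addr.
    by move=> j; apply: rabs_ge0.
by exists w; split=> //; apply: rle_trans (rabs_ge0 (x 0%N)) (key 0%N).
Qed.

(** The order is Archimedean because [n] times the positive part of [x] stays below that of [u], so
    its norm is at most a constant over [n]. *)
Lemma rarchi x u : (forall n : nat, n%:R *: x <<= u) -> x <<= 0.
Proof.
move=> h; have [M hM] := nbd_ex L u.
have key n : n%:R *: rpos x <<= rpos u.
  case: n => [|n]; first by rewrite scale0r; apply: rpos_ge0.
  have n0 : 0 < n.+1%:R :> R by rewrite ltr0n.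
  suff hh : rpos x <<= n.+1%:R^-1 *: rpos u.
    have := @rle_scale _ _ L n.+1%:R _ _ (ltW n0) hh.
    by rewrite scalerA divff ?gt_eqF // scale1r.
  apply: rjoin_lub; last by apply: rscale_ge0 (rpos_ge0 _); rewrite invr_ge0 ltW.
  have := @rle_scale _ _ L n.+1%:R^-1 _ _ ltac:(by rewrite invr_ge0 ltW) (h n.+1).
  rewrite scalerA mulVf ?gt_eqF // scale1r => /rle_trans; apply.
  by apply: rle_scale; [rewrite invr_ge0 ltW|apply: rpos_ge].
suff hx : rpos x = 0 by rewrite -hx; apply: rpos_ge.
have M0 := nbd_ge0 hM.
apply: (@nbd_sep _ _ L) => e e0.
pose n := (Num.bound (M / e)).+1.
have n0 : 0 < n%:R :> R by rewrite ltr0n.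
have hn : M <= n%:R * e.
  rewrite -ler_pdivrMr //; apply: ltW; apply: lt_trans (archi_boundP _) _.
    by rewrite divr_ge0 // ltW.
  by rewrite ltr_nat.
have : nbd L (n%:R *: rpos x) M.
  apply: nbd_mono hM; rewrite rabs_id; last exact: rscale_ge0 (ltW n0) (rpos_ge0 _).
  exact: rle_trans (key n) (rpos_le_abs _).
move=> /(nbdZ n%:R^-1); rewrite scalerA mulVf ?gt_eqF // scale1r => /nbd_le; apply.
by rewrite ger0_norm ?invr_ge0 ?ler0n // ler_pdivrMl.
Qed.

End Lattice.

Section Suprema.
Variable R : realType.
Implicit Types (S : set R) (b : R).

Lemma le_sup_of S b s : (forall t, S t -> t <= b) -> S s -> s <= sup S.
Proof. by move=> hb; apply: ub_le_sup; exists b. Qed.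

Lemma sup_le_of S b s : S s -> (forall t, S t -> t <= b) -> sup S <= b.
Proof. by move=> hs hb; apply: ge_sup => //; exists s. Qed.

End Suprema.

(** * Linear functionals *)

Section Functionals.
Variables (R : realType) (V : lmodType R) (L : nlat V).
Implicit Types (x y z : V) (f g : V -> R).

Local Notation "x <<= y" := (rle L x y) (at level 70, no associativity).
Local Notation abs := (rabs L).
Local Notation pos := (rpos L).
Local Ltac mring := lazymatch goal with |- ?a = ?b => lmod_of R V a b end.

Definition lin f := forall (a : R) x y, f (a *: x + y) = a * f x + f y.

Definition bdd f := lin f /\ exists C : R, forall x M, nbd L x M -> `|f x| <= C * M.

Definition obdd f := forall u, exists B : R, forall y, abs y <<= u -> `|f y| <= B.

Definition posf f := forall x, 0 <<= x -> 0 <= f x.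

Section LinTheory.
Variable f : V -> R.
Hypothesis hf : lin f.

Lemma linD x y : f (x + y) = f x + f y.
Proof. by have := hf 1 x y; rewrite scale1r mul1r. Qed.

Lemma lin0 : f 0 = 0.
Proof. by have := linD 0 0; rewrite addr0; lra. Qed.

Lemma linZ a x : f (a *: x) = a * f x.
Proof. by have := hf a x 0; rewrite addr0 lin0 addr0. Qed.

Lemma linN x : f (- x) = - f x.
Proof. by have := linZ (-1) x; rewrite scaleN1r mulN1r. Qed.

Lemma linB x y : f (x - y) = f x - f y.
Proof. by rewrite linD linN. Qed.

Lemma lin_sum (x : nat -> V) n : f (\sum_(i < n) x i) = \sum_(i < n) f (x i).
Proof.
elim: n => [|n IHn]; first by rewrite !big_ord0 lin0.
by rewrite !big_ord_recr /= linD IHn.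
Qed.

Lemma posf_le x y : posf f -> x <<= y -> f x <= f y.
Proof. by move=> hp /rle_subl /hp; rewrite linB subr_ge0. Qed.

Lemma posf_abs y : posf f -> `|f y| <= f (abs y).
Proof.
move=> hp; rewrite ler_norml; apply/andP; split.
  rewrite lerNl -linN; apply: posf_le => //; exact: rabs_geN.
by apply: posf_le => //; exact: rabs_ge.
Qed.

(* A functional failing to be norm bounded blows up on vectors of geometrically
   decaying norm; completeness puts these into one order interval. *)
Lemma obdd_bdd : obdd f -> bdd f.
Proof.
move=> ho; split=> //; apply: contrapT => /forallNP h.
have {}h n : exists x, nbd L x (4^-1 ^+ n) /\ n%:R < `|f x|.
  (* The constant [n * 4^n] fails at some [x]; scaling [x] down to norm [4^-n] leaves a value above
     [n]. When [M = 0], every multiple of [x] has norm bound zero and the scaling is free. *)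
  have /existsNP[x /existsNP[M /not_implyP[hM /negP]]] := h (n%:R * 4 ^+ n).
  rewrite -ltNge => hlt; have M0 := nbd_ge0 hM.
  have q0 : 0 < 4^-1 ^+ n :> R by rewrite exprn_gt0 // invr_gt0.
  have e4 : 4 ^+ n * 4^-1 ^+ n = 1 :> R by rewrite -exprMn divff ?expr1n.
  case: (ltP 0 M) => [Mp|Mn].
    exists (4^-1 ^+ n / M *: x); split.
      have := nbdZ (4^-1 ^+ n / M) hM; rewrite ger0_norm ?divfK ?gt_eqF //.
      by rewrite divr_ge0 // ltW.
    rewrite linZ normrM ger0_norm; last by rewrite divr_ge0 // ltW.
    rewrite mulrAC ltr_pdivlMr //.
    have -> : n%:R * M = 4^-1 ^+ n * (n%:R * 4 ^+ n * M).
      by rewrite -[LHS]mul1r -[X in X * _ = _]e4; ring.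
    by rewrite ltr_pM2l.
  have M00 : M = 0 by apply/eqP; rewrite eq_le Mn.
  move: hlt hM; rewrite M00 mulr0 => fx hx.
  exists ((n%:R + 1) / `|f x| *: x); split.
    by have := nbdZ ((n%:R + 1) / `|f x|) hx; rewrite mulr0 => /nbd_le; apply; apply: ltW.
  rewrite linZ normrM ger0_norm; last by rewrite divr_ge0 // addr_ge0.
  by rewrite divfK ?gt_eqF // ltrDl.
have /choice[x hx] := h.
have [w [w0 hw]] := nbd_dominated (fun n => (hx n).1).
have [B hB] := ho w.
suff : 1 <= 0 :> R by lra.
apply: (@archi_le0 _ 1 B) => n; rewrite mulr1.
exact: le_trans (ltW (hx n).2) (hB _ (hw n)).
Qed.

Lemma posf_bdd : posf f -> bdd f.
Proof.
move=> hp; apply: obdd_bdd => u; exists (f u) => y hy.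
exact: le_trans (posf_abs _ hp) (posf_le hp hy).
Qed.

End LinTheory.

Lemma lin_eq_cone f g : lin f -> lin g -> (forall x, 0 <<= x -> f x = g x) -> f = g.
Proof.
move=> hf hg h; apply/funext => x; rewrite (rposB L x) !linB //.
by rewrite !h //; apply: rpos_ge0.
Qed.

Lemma bdd_obdd f : bdd f -> obdd f.
Proof.
move=> [_ [C hC]] u; have [M hM] := nbd_ex L u; exists (C * M) => y hy.
by apply: hC; apply: nbd_mono hM; apply: rle_trans hy (rabs_ge _ _).
Qed.

(** Kantorovich's extension to the whole space of an additive map on the cone; it produces all the
    functionals constructed from suprema below. *)
Definition pext (p : V -> R) x : R := p (pos x) - p (pos (- x)).

Section PosExt.
Variable p : V -> R.
Hypothesis pD : forall x y, 0 <<= x -> 0 <<= y -> p (x + y) = p x + p y.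
Hypothesis p_ge0 : forall x, 0 <<= x -> 0 <= p x.

(** The value does not depend on the decomposition, because [a + pos (- (a - b)) = pos (a - b) + b]
    and [p] is additive. *)
Lemma pextE a b : 0 <<= a -> 0 <<= b -> pext p (a - b) = p a - p b.
Proof.
move=> a0 b0; rewrite /pext.
have := pD (rpos_ge0 L (a - b)) b0; have := pD a0 (rpos_ge0 L (- (a - b))).
have -> : a + pos (- (a - b)) = pos (a - b) + b by rewrite rposN; mring.
lra.
Qed.

Lemma pext_cone x : 0 <<= x -> pext p x = p x.
Proof.
move=> x0; have := pextE x0 (rle_refl L 0); rewrite subr0 => ->.
by have := pD (rle_refl L 0) (rle_refl L 0); rewrite addr0; lra.
Qed.

Lemma padd_mono x y : 0 <<= x -> x <<= y -> p x <= p y.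
Proof.
move=> x0 /rle_subl xy; have := pD x0 xy; have := p_ge0 xy.
by rewrite (_ : x + (y - x) = y); [lra|mring].
Qed.

Lemma padd_nat k x : 0 <<= x -> p (k%:R *: x) = k%:R * p x.
Proof.
move=> x0; elim: k => [|k IHk].
  by rewrite scale0r mul0r; have := pD (rle_refl L 0) (rle_refl L 0); rewrite addr0; lra.
by rewrite -natr1 scalerDl scale1r pD // ?IHk ?mulrDl ?mul1r //; apply: rscale_ge0.
Qed.

(** With [k] the integer part of [n * t], monotonicity puts both [n * p (t *: x)] and [n * t * p x]
    between [k * p x] and [(k + 1) * p x]. Their difference is thus bounded uniformly in [n]. *)
Lemma padd_scale t x : 0 <= t -> 0 <<= x -> p (t *: x) = t * p x.
Proof.
move=> t0 x0; apply/eqP; rewrite -subr_eq0 -normr_eq0 eq_le normr_ge0 andbT.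
apply: (@archi_le0 _ _ (p x)) => n; rewrite -[X in X * _]ger0_norm // -normrM.
have nt0 : 0 <= n%:R * t by rewrite mulr_ge0.
pose k := Num.truncn (n%:R * t).
have /andP[k1 k2] := truncn_itv nt0.
have E : p ((n%:R * t) *: x) = n%:R * p (t *: x).
  by rewrite -scalerA padd_nat //; apply: rscale_ge0.
have h1 : k%:R * p x <= n%:R * p (t *: x).
  by rewrite -(padd_nat k) // -E; apply: padd_mono; [apply: rscale_ge0|apply: rscale_le].
have h2 : n%:R * p (t *: x) <= k.+1%:R * p x.
  rewrite -(padd_nat k.+1) // -E; apply: padd_mono; first exact: rscale_ge0.
  by apply: rscale_le => //; apply: ltW.
have h3 : k%:R * p x <= n%:R * t * p x by apply: ler_wpM2r => //; apply: p_ge0.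
have h4 : n%:R * t * p x <= k.+1%:R * p x by apply: ler_wpM2r; [apply: p_ge0|apply: ltW].
rewrite mulrBr mulrA; move: h2 h4; rewrite -natr1 mulrDl mul1r => h2 h4.
by rewrite ler_norml; apply/andP; split; lra.
Qed.

Lemma pext_lin : lin (pext p).
Proof.
have hD x y : pext p (x + y) = pext p x + pext p y.
  have -> : x + y = (pos x + pos y) - (pos (- x) + pos (- y)) by rewrite !rposN; mring.
  rewrite pextE; [|by apply: radd_ge0; apply: rpos_ge0..].
  rewrite !pD; [|by apply: rpos_ge0..]; rewrite /pext; lra.
have hZ t x : 0 <= t -> pext p (t *: x) = t * pext p x.
  move=> t0; have -> : t *: x = t *: pos x - t *: pos (- x) by rewrite !rposN; mring.
  rewrite pextE; [|by apply: rscale_ge0 => //; apply: rpos_ge0..].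
  by rewrite !padd_scale // ?mulrBr //; apply: rpos_ge0.
have hN x : pext p (- x) = - pext p x by rewrite /pext opprK opprB.
move=> a x y; rewrite hD; congr (_ + _); case: (leP 0 a) => [/hZ //|a0].
by rewrite -[a]opprK scaleNr hN hZ ?mulNr // oppr_ge0 ltW.
Qed.

Lemma pext_pos : posf (pext p).
Proof. by move=> x x0; rewrite pext_cone //; apply: p_ge0. Qed.

End PosExt.

(** * The Riesz-Kantorovich modulus *)

(** On the lattice of a Banach space this is convertible to [dual_abs_pos], and [dabs] to
    [dual_abs]. *)
Definition dabs_pos f x : R := sup [set r | exists y, abs y <<= x /\ r = `|f y|].
Definition dabs f : V -> R := pext (dabs_pos f).

Section Modulus.
Variable f : V -> R.
Hypothesis bf : bdd f.
Let hf : lin f := bf.1.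

Lemma dabs_pos_ge x y : abs y <<= x -> `|f y| <= dabs_pos f x.
Proof.
move=> hy; have [B hB] := bdd_obdd bf x.
by apply: (@le_sup_of _ _ B) => [r [z [hz ->]]|]; [apply: hB|exists y].
Qed.

Lemma dabs_pos_le x (b : R) : 0 <<= x ->
  (forall y, abs y <<= x -> `|f y| <= b) -> dabs_pos f x <= b.
Proof.
move=> x0 h; apply: (@sup_le_of _ _ b `|f 0|) => [|r [y [hy ->]]]; last exact: h.
by exists 0; rewrite rabs0.
Qed.

Lemma dabs_pos_ge0 x : 0 <<= x -> 0 <= dabs_pos f x.
Proof.
by move=> x0; apply: le_trans (normr_ge0 (f 0)) (dabs_pos_ge _); rewrite rabs0.
Qed.

Lemma dabs_pos_add x y : 0 <<= x -> 0 <<= y ->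
  dabs_pos f (x + y) = dabs_pos f x + dabs_pos f y.
Proof.
move=> x0 y0; apply/eqP; rewrite eq_le; apply/andP; split.
  apply: dabs_pos_le => [|z hz]; first exact: radd_ge0.
  have [z1 [z2 [-> h1 h2]]] := riesz_dec_abs hz x0 y0.
  rewrite linD //; apply: le_trans (ler_normD _ _) (lerD _ _); exact: dabs_pos_ge.
rewrite -lerBrDr; apply: dabs_pos_le => // z hz.
rewrite lerBrDl -lerBrDr; apply: dabs_pos_le => // z' hz'.
rewrite lerBrDl.
(* The signs of [z] and [z'] are free, so the sum of the two absolute values is one of four values
   of [f] on the interval of [x + y]. *)
have key s t : abs s <<= x -> abs t <<= y -> f s + f t <= dabs_pos f (x + y).
  move=> hs ht; rewrite -linD //; apply: le_trans (ler_norm _) (dabs_pos_ge _).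
  exact: rle_trans (rabsD _ _ _) (rleD hs ht).
have hzN : abs (- z) <<= x by rewrite rabsN.
have hzN' : abs (- z') <<= y by rewrite rabsN.
have := key _ _ hz hz'; have := key _ _ hzN hz'; have := key _ _ hz hzN'.
have := key _ _ hzN hzN'; rewrite !linN //.
by case: (ger0P (f z)) => _; case: (ger0P (f z')) => _; lra.
Qed.

Lemma dabsE x : 0 <<= x -> dabs f x = dabs_pos f x.
Proof. exact: pext_cone dabs_pos_add x. Qed.

Lemma dabs_lin : lin (dabs f).
Proof. exact: pext_lin dabs_pos_add dabs_pos_ge0. Qed.

Lemma dabs_posf : posf (dabs f).
Proof. exact: pext_pos dabs_pos_add dabs_pos_ge0. Qed.

Lemma dabs_bdd : bdd (dabs f).
Proof. exact: posf_bdd dabs_lin dabs_posf. Qed.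

Lemma dabs_ge x y : abs y <<= x -> `|f y| <= dabs f x.
Proof.
move=> h; rewrite dabsE; first exact: dabs_pos_ge.
exact: rle_trans (rabs_ge0 _ _) h.
Qed.

Lemma dabs_le x (b : R) : 0 <<= x ->
  (forall y, abs y <<= x -> `|f y| <= b) -> dabs f x <= b.
Proof. by move=> x0 h; rewrite dabsE //; apply: dabs_pos_le. Qed.

(** The modulus is the least upper bound of [f] and [- f]: evaluating [f] on the two parts of [y]
    bounds its absolute value at [y] by [g (abs y)]. *)
Lemma dabs_lub g : lin g -> (forall x, 0 <<= x -> f x <= g x) ->
  (forall x, 0 <<= x -> - f x <= g x) -> forall x, 0 <<= x -> dabs f x <= g x.
Proof.
move=> hg h1 h2 x x0; apply: dabs_le => // y hy.
have hp : posf g by move=> z z0; have := h1 _ z0; have := h2 _ z0; lra.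
apply: le_trans (posf_le hg hp hy); rewrite rabsE linD //.
rewrite {1}(rposB L y) linB // ler_norml.
have := h1 _ (rpos_ge0 L y); have := h2 _ (rpos_ge0 L y).
have := h1 _ (rpos_ge0 L (- y)); have := h2 _ (rpos_ge0 L (- y)).
by move=> *; apply/andP; split; lra.
Qed.

End Modulus.

End Functionals.

(** * Limits of sequences with geometrically decaying increments *)

Section GeometricCauchy.
Variables (R : realType) (W : completeNormedModType R).

Lemma geometric_steps (u : nat -> W) (c : R) : 0 <= c ->
  (forall n, `|u n.+1 - u n| <= c * 4^-1 ^+ n) ->
  forall n k, `|u (n + k)%N - u n| <= 2 * c * 4^-1 ^+ n.
Proof.
move=> c0 h n k.
(* The induction needs this sharper bound: a step costs [c * 4^-m], and the right side gains
   [3/2 * c * 4^-m]. *)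
suff : `|u (n + k)%N - u n| <= 2 * c * (4^-1 ^+ n - 4^-1 ^+ (n + k)).
  move=> /le_trans; apply; apply: ler_wpM2l; first by rewrite mulr_ge0.
  by rewrite gerBl exprn_ge0 // invr_ge0.
elim: k => [|k IHk]; first by rewrite addn0 !subrr normr0 mulr0.
rewrite addnS; have := ler_normD (u (n + k).+1 - u (n + k)%N) (u (n + k)%N - u n).
rewrite addrA subrK => /le_trans; apply.
apply: le_trans (lerD (h _) IHk) _; rewrite exprS.
have : 0 <= c * 4^-1 ^+ (n + k) by rewrite mulr_ge0 // exprn_ge0 // invr_ge0.
move: (4^-1 ^+ (n + k)) (4^-1 ^+ n) => s t; lra.
Qed.

Lemma geometric_cvg (u : nat -> W) (c : R) : 0 <= c ->
  (forall n, `|u n.+1 - u n| <= c * 4^-1 ^+ n) ->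
  exists l, forall n, `|l - u n| <= 2 * c * 4^-1 ^+ n.
Proof.
move=> c0 h; have hs := geometric_steps c0 h.
have q01 : 0 <= (4^-1 : R) < 1 by apply/andP; split; lra.
have /cvg_ex[l hl] : cvgn u.
  apply: cauchy_cvg; apply/cauchy_ballP => e e0.
  have e8 : 0 < e / 4 by lra.
  have [N hN] := null_geom (2 * c) q01 e8.
  exists ([set x | exists n, (N <= n)%N /\ x = u n],
          [set x | exists n, (N <= n)%N /\ x = u n]) => /=.
    by split; exists N => // n nN; exists n.
  move=> [x y] /= [[n [nN ->]] [m [mN ->]]].
  rewrite -ball_normE /=.
  have step i : (N <= i)%N -> `|u i - u N| <= e / 4.
    move=> Ni; rewrite -(subnKC Ni); apply: le_trans (hs _ _) _.
    exact: le_trans (ler_norm _) (hN N (leqnn N)).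
  have := ler_normB (u n - u N) (u m - u N).
  rewrite opprB addrA subrK; have := step _ nN; have := step _ mN; lra.
exists l => n; apply/ler_addgt0Pr => e e0.
move/cvgrPdist_le : hl => /(_ e e0)[N _ hN].
have := hN (n + N)%N (leq_addl _ _) => /= hlN.
have := ler_normD (l - u (n + N)%N) (u (n + N)%N - u n).
by rewrite addrA subrK; have := hs n N; lra.
Qed.

End GeometricCauchy.

(** * The dual lattice *)

Section DualType.
Variables (R : realType) (V : lmodType R) (L : nlat V).
Implicit Types f g : V -> R.

Local Notation "x <<= y" := (rle L x y) (at level 70, no associativity).

Record dual := Dual { dfun :> V -> R ; dualP : bdd L dfun }.

Lemma dual_ext (f g : dual) : (forall x, f x = g x) -> f = g.
Proof.
case: f g => [f hf] [g hg] /= h; have e : f = g by apply/funext.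
by case: g / e hg {h} => hg; congr Dual; apply: Prop_irrelevance.
Qed.

Lemma bddP f : bdd L f ->
  lin f /\ exists2 C : R, 0 <= C & forall x M, nbd L x M -> `|f x| <= C * M.
Proof.
move=> [hf [C hC]]; split=> //; exists `|C| => // x M hM.
apply: le_trans (hC _ _ hM) _; apply: ler_wpM2r; first exact: nbd_ge0 hM.
exact: ler_norm.
Qed.

Lemma bdd_comb (a : R) f g : bdd L f -> bdd L g -> bdd L (fun x => a * f x + g x).
Proof.
move=> [hf [C hC]] [hg [D hD]]; split; first by move=> t x y; rewrite hf hg; ring.
exists (`|a| * C + D) => x M hM; rewrite mulrDl.
apply: le_trans (ler_normD _ _) (lerD _ (hD _ _ hM)).
by rewrite normrM -mulrA ler_wpM2l // hC.
Qed.

Lemma bdd0 : bdd L (fun=> 0).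
Proof.
split=> [a x y|]; first by rewrite mulr0 addr0.
by exists 0 => x M _; rewrite normr0 mul0r.
Qed.

Lemma bdd_add f g : bdd L f -> bdd L g -> bdd L (fun x => f x + g x).
Proof.
move=> hf hg; have := bdd_comb 1 hf hg; congr (bdd L _).
by apply/funext => x; rewrite mul1r.
Qed.

Lemma bdd_scale (a : R) f : bdd L f -> bdd L (fun x => a * f x).
Proof.
move=> hf; have := bdd_comb a hf bdd0; congr (bdd L _).
by apply/funext => x; rewrite addr0.
Qed.

Lemma bdd_opp f : bdd L f -> bdd L (fun x => - f x).
Proof.
move=> hf; have := bdd_scale (-1) hf; congr (bdd L _).
by apply/funext => x; rewrite mulN1r.
Qed.

HB.instance Definition _ := gen_eqMixin dual.
HB.instance Definition _ := gen_choiceMixin dual.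

Definition dual_zero : dual := Dual bdd0.
Definition dual_add (f g : dual) : dual := Dual (bdd_add (dualP f) (dualP g)).
Definition dual_opp (f : dual) : dual := Dual (bdd_opp (dualP f)).
Definition dual_scale (a : R) (f : dual) : dual := Dual (bdd_scale a (dualP f)).

Lemma dual_addA : associative dual_add.
Proof. by move=> f g h; apply: dual_ext => x; apply: addrA. Qed.
Lemma dual_addC : commutative dual_add.
Proof. by move=> f g; apply: dual_ext => x; apply: addrC. Qed.
Lemma dual_add0 : left_id dual_zero dual_add.
Proof. by move=> f; apply: dual_ext => x; apply: add0r. Qed.
Lemma dual_addN : left_inverse dual_zero dual_opp dual_add.
Proof. by move=> f; apply: dual_ext => x; apply: addNr. Qed.

HB.instance Definition _ :=
  GRing.isZmodule.Build dual dual_addA dual_addC dual_add0 dual_addN.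

Lemma dual_scaleA a b (f : dual) :
  dual_scale a (dual_scale b f) = dual_scale (a * b) f.
Proof. by apply: dual_ext => x; apply: mulrA. Qed.
Lemma dual_scale1 : left_id 1 dual_scale.
Proof. by move=> f; apply: dual_ext => x; apply: mul1r. Qed.
Lemma dual_scaleDr : right_distributive dual_scale +%R.
Proof. by move=> a f g; apply: dual_ext => x; apply: mulrDr. Qed.
Lemma dual_scaleDl (f : dual) : {morph dual_scale^~ f : a b / a + b}.
Proof. by move=> a b; apply: dual_ext => x; apply: mulrDl. Qed.

HB.instance Definition _ :=
  GRing.Zmodule_isLmodule.Build R dual dual_scaleA dual_scale1 dual_scaleDr dual_scaleDl.

Lemma dualDE (f g : dual) x : (f + g) x = f x + g x. Proof. by []. Qed.
Lemma dualNE (f : dual) x : (- f) x = - f x. Proof. by []. Qed.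
Lemma dualZE a (f : dual) x : (a *: f) x = a * f x. Proof. by []. Qed.
Definition dual_modulus (f : dual) : dual := Dual (dabs_bdd (dualP f)).

Definition dual_le (f g : dual) := forall x, 0 <<= x -> f x <= g x.
(** The join is obtained from the modulus as half of [f + g + |f - g|]. *)
Definition dual_join (f g : dual) : dual :=
  2^-1 *: (f + g + dual_modulus (f - g)).
Definition dual_nbd (f : dual) (M : R) :=
  0 <= M /\ forall x K, nbd L x K -> `|f x| <= M * K.

Lemma dual_joinE (f g : dual) x :
  dual_join f g x = 2^-1 * (f x + g x + dabs L (f - g) x).
Proof. by []. Qed.

Lemma dual_le_anti (f g : dual) : dual_le f g -> dual_le g f -> f = g.
Proof.
move=> h1 h2; apply: dual_ext => x.
suff -> : dfun f = dfun g by [].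
apply: (lin_eq_cone (L := L) (dualP f).1 (dualP g).1) => y y0.
by apply/eqP; rewrite eq_le; apply/andP; split; [apply: h1|apply: h2].
Qed.

Lemma dual_modulus_ge (f : dual) x : 0 <<= x -> `|f x| <= dabs L f x.
Proof. by move=> x0; apply: (dabs_ge (dualP f)); rewrite rabs_id //; apply: rle_refl. Qed.

Lemma dual_join_ubl (f g : dual) : dual_le f (dual_join f g).
Proof.
move=> x x0; rewrite dual_joinE; have := dual_modulus_ge (f - g) x0.
by rewrite ler_norml => /andP[]; rewrite dualDE dualNE; lra.
Qed.

Lemma dual_join_ubr (f g : dual) : dual_le g (dual_join f g).
Proof.
move=> x x0; rewrite dual_joinE; have := dual_modulus_ge (f - g) x0.
by rewrite ler_norml => /andP[]; rewrite dualDE dualNE; lra.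
Qed.

Lemma dual_join_lub (f g h : dual) : dual_le f h -> dual_le g h -> dual_le (dual_join f g) h.
Proof.
move=> fh gh x x0; rewrite dual_joinE.
suff : dabs L (f - g) x <= (h + h - f - g) x by rewrite !dualDE !dualNE; lra.
apply: (dabs_lub (dualP (f - g)) (dualP (h + h - f - g)).1) => // y y0.
  by rewrite !dualDE !dualNE; have := fh _ y0; have := gh _ y0; lra.
by rewrite !dualDE !dualNE; have := fh _ y0; have := gh _ y0; lra.
Qed.

Lemma dual_join_abs (f : dual) : dual_join f (- f) = dual_modulus f.
Proof.
apply: dual_le_anti.
  apply: dual_join_lub => x x0; rewrite /= ?dualNE.
    by apply: le_trans (ler_norm _) (dual_modulus_ge _ _).
  by apply: le_trans (dual_modulus_ge _ x0); rewrite -normrN ler_norm.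
move=> x x0; apply: (dabs_lub (dualP f) (dualP (dual_join f (- f))).1) => // y y0.
  exact: (dual_join_ubl f (- f) y0).
exact: (dual_join_ubr f (- f) y0).
Qed.

Lemma dual_nbd_abs (f : dual) M x K : dual_nbd f M -> nbd L x K ->
  dabs L f (rabs L x) <= M * K.
Proof.
move=> [M0 hM] hK; apply: (dabs_le (dualP f)) => [|y hy]; first exact: rabs_ge0.
by apply: hM; apply: nbd_mono hK.
Qed.

(** The limit is taken pointwise. The rate at [x] is proportional to any norm bound of [x], which
    makes the convergence uniform on bounded sets. *)
Lemma dual_nbd_complete (f : nat -> dual) :
  (forall n, dual_nbd (f n.+1 - f n) (4^-1 ^+ n)) ->
  exists g : dual, forall n, dual_nbd (g - f n) (2 * 4^-1 ^+ n).
Proof.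
move=> hf.
(* The limit is chosen before the norm bound [K], so that one value obeys the rate for all bounds of
   [x]. *)
have ptw x : exists l : R, forall K, nbd L x K -> forall n,
    `|l - f n x| <= 2 * K * 4^-1 ^+ n.
  have [K0 hK0] := nbd_ex L x.
  have key K : nbd L x K -> exists l : R, forall n, `|l - f n x| <= 2 * K * 4^-1 ^+ n.
    move=> hK; apply: (@geometric_cvg R R^o); first exact: nbd_ge0 hK.
    by move=> n; have [_ /(_ _ _ hK)] := hf n; rewrite mulrC.
  have [l hl] := key _ hK0; exists l => K hK; have [l' hl'] := key _ hK.
  suff -> : l = l' by [].
  apply/eqP; rewrite -subr_eq0 -normr_eq0 eq_le normr_ge0 andbT.
  apply: (@le_null_geom _ _ 0 (2 * K0 + 2 * K) 4^-1) => [|n].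
    by apply/andP; split; lra.
  have := ler_normB (l - f n x) (l' - f n x).
  rewrite opprB addrA subrK; have := hl n; have := hl' n; lra.
have /choice[g hg] := ptw.
have lg : lin g.
  move=> a x y; have [K hK] := nbd_ex L x; have [K' hK'] := nbd_ex L y.
  have hKK := nbdD (nbdZ a hK) hK'.
  apply/eqP; rewrite -subr_eq0 -normr_eq0 eq_le normr_ge0 andbT.
  apply: (@le_null_geom _ _ 0 (2 * (`|a| * K + K') + `|a| * (2 * K) + 2 * K') 4^-1) => [|n].
    by apply/andP; split; lra.
  have hC := hg _ _ hKK n; rewrite (dualP (f n)).1 in hC.
  have hB := ler_wpM2l (normr_ge0 a) (hg _ _ hK n); rewrite -normrM in hB.
  have hA := hg _ _ hK' n.
  have -> : g (a *: x + y) - (a * g x + g y) =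
    g (a *: x + y) - (a * f n x + f n y) - a * (g x - f n x) - (g y - f n y) by ring.
  apply: le_trans (ler_normB _ _) _.
  have := ler_normB (g (a *: x + y) - (a * f n x + f n y)) (a * (g x - f n x)).
  lra.
have bnd n x K : nbd L x K -> `|g x - f n x| <= 2 * 4^-1 ^+ n * K.
  by move=> hK; apply: le_trans (hg _ _ hK n) _; rewrite mulrAC.
have bg : bdd L g.
  split=> //; have [_ [C hC]] := dualP (f 0%N); exists (2 + C) => x M hM.
  have := bnd 0%N _ _ hM; rewrite expr0 mulr1 => h1; have := hC _ _ hM.
  have := ler_normD (g x - f 0%N x) (f 0%N x); rewrite subrK; lra.
exists (Dual bg) => n; split; first by rewrite mulr_ge0 // exprn_ge0 // invr_ge0.
by move=> x K hK; apply: bnd.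
Qed.

Definition dual_nlat : nlat dual.
Proof.
refine (@NLat R dual dual_le dual_join dual_nbd _ _ _ _ _ _ _ _ _ _ _ _ _ _ _ _).
- by move=> f x _.
- by move=> f g h fg gh x x0; apply: le_trans (fg _ x0) (gh _ x0).
- exact: dual_le_anti.
- by move=> f g h fg x x0; rewrite !dualDE lerD2r fg.
- by move=> a f g a0 fg x x0; rewrite !dualZE ler_wpM2l // fg.
- exact: dual_join_ubl.
- exact: dual_join_ubr.
- exact: dual_join_lub.
- by move=> f; have [_ [C C0 hC]] := bddP (dualP f); exists C.
- by move=> f M [].
- move=> f M M' [M0 h] MM'; split; first exact: le_trans MM'.
  move=> x K hK; apply: le_trans (h _ _ hK) _.
  by apply: ler_wpM2r => //; apply: nbd_ge0 hK.
- move=> a f M [M0 h]; split=> [|x K hK]; first by rewrite mulr_ge0.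
  by rewrite dualZE normrM -mulrA ler_wpM2l // h.
- move=> f g M M' [M0 h] [M0' h']; split=> [|x K hK]; first exact: addr_ge0.
  rewrite mulrDl dualDE; apply: le_trans (ler_normD _ _) (lerD _ _).
    exact: h.
  exact: h'.
- move=> f h; apply: dual_ext => x; have [K hK] := nbd_ex L x.
  have K0 := nbd_ge0 hK.
  apply/eqP; rewrite -normr_eq0 eq_le normr_ge0 andbT.
  apply/ler_addgt0Pr => e e0; rewrite add0r.
  have K1 : 0 < K + 1 by lra.
  have [_ /(_ _ _ hK) /le_trans] := h (e / (K + 1)) ltac:(by rewrite divr_gt0).
  by apply; rewrite mulrAC ler_pdivrMr // ler_wpM2l //; lra.
(* Solidity: the value of [f] at [x] is bounded by its modulus at [rabs x], then by that of [g],
   whose norm bound passes to its modulus. *)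
- move=> f g M; rewrite !dual_join_abs => fg [M0 hg]; split=> // x K hK.
  apply: le_trans (dabs_ge (dualP f) (rle_refl L _)) _.
  apply: le_trans (fg _ (rabs_ge0 L x)) _.
  exact: dual_nbd_abs.
- exact: dual_nbd_complete.
Defined.

Lemma dual_rabs (f : dual) : rabs dual_nlat f = dual_modulus f.
Proof. exact: dual_join_abs. Qed.

Lemma dual_rabsE (f : dual) x : rabs dual_nlat f x = dabs L f x.
Proof. by rewrite dual_rabs. Qed.

End DualType.

(** * Hahn-Banach and uniform boundedness *)

Section HahnBanach.
Variables (R : realType) (V : lmodType R).
Implicit Types (p q N : V -> R) (x y a : V).

Definition sublinear p :=
  (forall x y, p (x + y) <= p x + p y) /\ (forall (t : R) x, 0 <= t -> p (t *: x) = t * p x).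

Lemma sublinear0 p : sublinear p -> p 0 = 0.
Proof. by move=> [_ /(_ 0 0 (lexx _))]; rewrite scaler0 mul0r. Qed.

Lemma sublinear_opp p x : sublinear p -> - p (- x) <= p x.
Proof. by move=> hp; have := hp.1 x (- x); rewrite subrr (sublinear0 hp); lra. Qed.

(** Used twice: for the shift of a sublinear functional along a vector, and for the infimum of a
    chain in Zorn's lemma. *)
Lemma sublinear_inf (I : Type) (i0 : I) (F : I -> V -> R) :
  (forall x, exists b, forall i, b <= F i x) ->
  (forall i j x y, exists k, F k (x + y) <= F i x + F j y) ->
  (forall i t x, 0 < t -> exists k, F k (t *: x) <= t * F i x) ->
  (forall i, F i 0 = 0) ->
  let q x := inf [set r | exists i, r = F i x] in
  sublinear q /\ forall i x, q x <= F i x.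
Proof.
move=> lb hD hZ h0 q.
have qle i x : q x <= F i x.
  apply: ge_inf; last by exists i.
  by have [b hb] := lb x; exists b => r [j ->].
have qge x b : (forall i, b <= F i x) -> b <= q x.
  by move=> h; apply: lb_le_inf => [|r [i ->] //]; exists (F i0 x), i0.
have scl t x : 0 < t -> q (t *: x) <= t * q x.
  move=> t0; rewrite mulrC -ler_pdivrMr //; apply: (qge) => i.
  by rewrite ler_pdivrMr // mulrC; have [k] := hZ i t x t0; apply: le_trans.
split=> //; split=> [x y|t x].
  rewrite -lerBlDr; apply: (qge) => i; rewrite lerBlDr -lerBlDl.
  apply: (qge) => j; rewrite lerBlDl; have [k] := hD i j x y.
  exact: le_trans.
rewrite le_eqVlt => /orP[/eqP <-|t0].
  rewrite scale0r mul0r; apply/eqP; rewrite eq_le; apply/andP; split.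
    by rewrite -(h0 i0).
  by apply: (qge) => i; rewrite h0.
apply/eqP; rewrite eq_le scl //=.
have ti : 0 < t^-1 by rewrite invr_gt0.
have := scl t^-1 (t *: x) ti; rewrite scalerA mulVf ?gt_eqF // scale1r.
by rewrite mulrC ler_pdivlMr // mulrC.
Qed.

(* the largest sublinear functional below p that is at most - p a at - a *)
Definition sub_shift p a y : R :=
  inf [set r | exists t : {t : R | 0 <= t}, r = p (y + sval t *: a) - sval t * p a].

Lemma sub_shiftP p a : sublinear p ->
  [/\ sublinear (sub_shift p a), forall y, sub_shift p a y <= p y
     & sub_shift p a (- a) <= - p a].
Proof.
move=> hp.
have zero_ge0 : 0 <= 0 :> R by [].
have one_ge0 : 0 <= 1 :> R by [].
have [|||t|hs hle] := @sublinear_inf {t : R | 0 <= t} (exist _ 0 zero_ge0)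
  (fun t y => p (y + sval t *: a) - sval t * p a).
- move=> y; exists (- p (- y)) => -[t t0] /=.
  have := hp.1 (y + t *: a) (- y); rewrite addrAC subrr add0r hp.2 //; lra.
- move=> [s s0] [t t0] x y /=; exists (exist _ (s + t) (addr_ge0 s0 t0)) => /=.
  have := hp.1 (x + s *: a) (y + t *: a); rewrite addrACA -scalerDl; lra.
- move=> [s s0] t x t0 /=; exists (exist _ (t * s) (mulr_ge0 (ltW t0) s0)) => /=.
  by rewrite -scalerA -scalerDr hp.2 ?(ltW t0) // mulrBr mulrA.
- by case: t => t t0 /=; rewrite add0r hp.2 // subrr.
split=> //.
- by move=> y; have := hle (exist _ 0 zero_ge0) y; rewrite /= scale0r addr0 mul0r subr0.
- have := hle (exist _ 1 one_ge0) (- a).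
  by rewrite /= scale1r addNr mul1r sublinear0 // sub0r.
Qed.

(* A minimal sublinear functional is linear. *)
Lemma sublinear_dominates N : sublinear N ->
  exists2 f : V -> R, lin f & forall x, f x <= N x.
Proof.
move=> hN; pose T := {p : V -> R | sublinear p /\ forall x, p x <= N x}.
(* The order is reversed, so that a maximal element for Zorn is a minimal functional. The empty
   chain is bounded by [N] itself. *)
pose below (p q : T) := `[< forall x, sval q x <= sval p x >].
have [|||A totA|[p [hp pN]] pmin] := @Zorn T below.
- by move=> p; apply/asboolP.
- move=> p q r /asboolP pq /asboolP qr; apply/asboolP => x.
  exact: le_trans (qr x) (pq x).
- move=> [p hp] [q hq] /asboolP /= pq /asboolP /= qp.
  have e : p = q by apply/funext => x; apply/eqP; rewrite eq_le pq qp.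
  by case: q / e hq {pq qp} => hq; congr exist; apply: Prop_irrelevance.
- have [[p0 Ap0]|nA] := pselect (exists p : T, A p); last first.
    have hNN : sublinear N /\ forall x, N x <= N x by split.
    by exists (exist _ N hNN) => p Ap; case: nA; exists p.
  have [||||hs hle] := @sublinear_inf {i : T | A i} (exist _ p0 Ap0)
    (fun i => sval (sval i)).
  + move=> x; exists (- N (- x)) => -[[p [hp pN]] Ap] /=.
    by have := sublinear_opp x hp; have := pN (- x); lra.
  + move=> [p Ap] [q Aq] x y /=; have [/asboolP pq|/asboolP qp] := totA p q Ap Aq.
      exists (exist _ q Aq) => /=; have := (svalP q).1.1 x y; have := pq x.
      by set u := sval p x; lra.
    exists (exist _ p Ap) => /=; have := (svalP p).1.1 x y; have := qp y.
    by set u := sval q y; lra.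
  + move=> [p Ap] t x t0 /=; exists (exist _ p Ap) => /=.
    by rewrite (svalP p).1.2 // ltW.
  + by move=> [p Ap] /=; apply: sublinear0 (svalP p).1.
  set q := (fun x => inf _) in hs hle.
  have hq : sublinear q /\ forall x, q x <= N x.
    split=> // x; apply: le_trans (hle (exist _ p0 Ap0) x) _ => /=.
    exact: (svalP p0).2.
  exists (exist _ q hq) => p Ap; apply/asboolP => x /=.
  exact: (hle (exist _ p Ap) x).
(* By minimality the shift of [p] along [a] equals [p], which forces [p (- a) <= - p a]. *)
have podd a : p (- a) = - p a.
  have [s1 s2 s3] := sub_shiftP a hp.
  have hs : sublinear (sub_shift p a) /\ forall x, sub_shift p a x <= N x.
    by split=> // x; apply: le_trans (s2 x) (pN x).
  have /= e := pmin (exist _ _ hs) ltac:(by apply/asboolP).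
  have {}e : sub_shift p a = p by case: e.
  by move: s3; rewrite e; have := sublinear_opp a hp; lra.
exists p => // a x y.
have pD u v : p (u + v) = p u + p v.
  apply/eqP; rewrite eq_le hp.1 /=; have := hp.1 (- u) (- v).
  by rewrite -opprD !podd; lra.
rewrite pD; congr (_ + _); case: (leP 0 a) => [/hp.2 //|a0].
by rewrite -[a]opprK scaleNr podd hp.2 ?mulNr // oppr_ge0 ltW.
Qed.

End HahnBanach.

(** The norm is first shifted along [x0]; any linear functional below the shift is at most minus the
    norm of [x0] at [- x0]. *)
Lemma norming_functional (R : realType) (E : normedModType R) (x0 : E) :
  exists f : E -> R, [/\ lin f, forall y, `|f y| <= `|y| & f x0 = `|x0|].
Proof.
have hn : sublinear (fun x : E => `|x|).
  split=> [x y|t x t0]; first exact: ler_normD.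
  by rewrite normrZ ger0_norm.
have [s1 s2 s3] := sub_shiftP x0 hn.
have [f lf hf] := sublinear_dominates s1.
have fle y : f y <= `|y| := le_trans (hf y) (s2 y).
have fab y : `|f y| <= `|y|.
  by rewrite ler_norml fle andbT lerNl -(linN lf) -(normrN y).
exists f; split=> //; apply/eqP; rewrite eq_le fle /=.
by have := le_trans (hf (- x0)) s3; rewrite (linN lf) lerN2.
Qed.

(** * The uniform boundedness principle *)

Section UniformBoundedness.
Variables (R : realType) (V : lmodType R) (L : nlat V).

Local Ltac mring := lazymatch goal with |- ?a = ?b => lmod_of R V a b end.

(** [C] is the operator norm, the supremum over the unit ball, and [z] nearly attains it. *)
Lemma almost_norming (g : V -> R) : bdd L g -> exists C : R,
  [/\ 0 <= C, forall x M, nbd L x M -> `|g x| <= C * M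
    & 0 < C -> exists2 z, nbd L z 1 & 3 / 4 * C <= `|g z|].
Proof.
move=> bg; have [lg [D D0 hD]] := bddP bg.
pose S := [set r | exists z, nbd L z 1 /\ r = `|g z|].
have Sub r : S r -> r <= D by move=> [z [/hD + ->]]; rewrite mulr1.
have S0 : S 0 by exists 0; rewrite (lin0 lg) normr0; split=> //; apply: nbd0.
have C0 : 0 <= sup S by apply: (le_sup_of Sub).
exists (sup S); split=> //.
  move=> x M hM; have := nbd_ge0 hM; rewrite le_eqVlt => /orP[/eqP M0|M0].
    suff -> : x = 0 by rewrite (lin0 lg) normr0 -M0 mulr0.
    by apply: (@nbd_sep _ _ L) => e e0; apply: nbd_le hM _; rewrite -M0 ltW.
  rewrite -ler_pdivrMr //; apply: (le_sup_of Sub); exists (M^-1 *: x); split.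
    have := nbdZ M^-1 hM; rewrite ger0_norm ?mulVf ?gt_eqF //.
    by rewrite invr_ge0 ltW.
  rewrite (linZ lg) normrM mulrC (ger0_norm (x := M^-1)) //.
  by rewrite invr_ge0 ltW.
move=> Cp; have := @sup_adherent R S (sup S / 4) ltac:(lra).
case; first by split; [exists 0|exists D].
by move=> r [z [hz ->]] h; exists z => //; lra.
Qed.

(* Gliding hump in the form of A. Sokal. *)
Lemma uniform_bounded (g : nat -> V -> R) : (forall n, bdd L (g n)) ->
  (forall x, exists B : R, forall n, `|g n x| <= B) ->
  exists2 C : R, 0 <= C & forall n x M, nbd L x M -> `|g n x| <= C * M.
Proof.
move=> bg ptw.
have /choice[C hC] : forall n, exists C : R,
    [/\ 0 <= C, forall x M, nbd L x M -> `|g n x| <= C * M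
      & 0 < C -> exists2 z, nbd L z 1 & 3 / 4 * C <= `|g n z|].
  by move=> n; apply: almost_norming.
have [[B hB]|unb] := pselect (exists B : R, forall n, C n <= B).
  exists `|B| => // n x M hM; have [_ h _] := hC n.
  apply: le_trans (h _ _ hM) _; apply: ler_wpM2r; first exact: nbd_ge0 hM.
  exact: le_trans (hB n) (ler_norm _).
exfalso.
(* Growth [8^k] outweighs the step size [4^-k] and leaves [2^k]. *)
have /choice[s hs] : forall k : nat, exists n, 8 ^+ k < C n.
  move=> k; apply: contrapT => /forallNP h; apply: unb; exists (8 ^+ k) => n.
  by have /negP := h n; rewrite -leNgt.
have Cp k : 0 < C (s k) by apply: lt_trans (hs k); rewrite exprn_gt0.
have /choice[z hz] : forall k, exists z, nbd L z 1 /\ 3 / 4 * C (s k) <= `|g (s k) z|.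
  by move=> k; have [_ _ /(_ (Cp k))[z ? ?]] := hC (s k); exists z.
(* The sign of [w] is chosen so that the values at [x] and at the added vector do not cancel; the
   new value is at least as large as the one at [w]. *)
pose step k x : V := let w := 4^-1 ^+ k *: z k in
  if 0 <= g (s k) x * g (s k) w then x + w else x - w.
pose x := fix x k := if k is m.+1 then step m (x m) else 0.
have q0 k : 0 < 4^-1 ^+ k :> R by rewrite exprn_gt0 // invr_gt0.
have nw k : nbd L (4^-1 ^+ k *: z k) (4^-1 ^+ k).
  by have := nbdZ (4^-1 ^+ k) (hz k).1; rewrite mulr1 ger0_norm // ltW.
have hstep k : nbd L (x k.+1 - x k) (4^-1 ^+ k).
  rewrite /= /step; case: ifP => _.
    by rewrite [_ - _](_ : _ = 4^-1 ^+ k *: z k) //; mring.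
  have := nbdZ (-1) (nw k); rewrite normrN1 mul1r scaleN1r.
  by rewrite [_ - x k](_ : _ = - (4^-1 ^+ k *: z k)) //; mring.
have big k : 3 / 4 * (4^-1 ^+ k * C (s k)) <= `|g (s k) (x k.+1)|.
  have lg := (bg (s k)).1.
  have : 3 / 4 * (4^-1 ^+ k * C (s k)) <= `|g (s k) (4^-1 ^+ k *: z k)|.
    rewrite (linZ lg) normrM ger0_norm ?(ltW (q0 k)) // mulrCA.
    by apply: ler_wpM2l; [apply: ltW|apply: (hz k).2].
  move=> /le_trans; apply; rewrite /= /step.
  set u := x k; set w := _ *: _; case: ifP => [h|/negbT]; last rewrite -ltNge => h.
    rewrite (linD lg) -ler_sqr ?nnegrE // !real_normK ?num_real //; nra.
  rewrite (linB lg) -ler_sqr ?nnegrE // !real_normK ?num_real //; nra.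
have [y hy] := @nbd_complete _ _ L x hstep.
have [B hB] := ptw y.
suff : 1 <= 0 :> R by lra.
apply: (@archi_le0 _ 1 (4 * B)) => k; rewrite mulr1.
have lg := (bg (s k)).1; have [_ hCk _] := hC (s k).
have := hCk _ _ (hy k.+1); rewrite (linB lg) => h1.
have := ler_normB (g (s k) y) (g (s k) y - g (s k) (x k.+1)); rewrite subKr => h2.
have h3 := big k; have h4 := hB (s k).
have h5 : 2 ^+ k <= 4^-1 ^+ k * C (s k).
  have -> : 2 ^+ k = 4^-1 ^+ k * 8 ^+ k :> R.
    by rewrite -exprMn; congr (_ ^+ _); lra.
  by apply: ler_wpM2l; apply: ltW.
have h6 : k%:R <= 2 ^+ k :> R.
  by rewrite -natrX ler_nat ltnW // ltn_expl.
(* The rest [y - x k.+1] costs at most one half of this quantity, while [big] gives three quarters;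
   one quarter survives. *)
have h7 : C (s k) * (2 * 4^-1 ^+ k.+1) = 1 / 2 * (4^-1 ^+ k * C (s k)).
  by rewrite exprS; lra.
rewrite h7 in h1; move: h1 h3 h5; move: (4^-1 ^+ k * C (s k)) => c *; lra.
Qed.

Definition wnull (x : nat -> V) := forall phi, bdd L phi -> null (fun n => phi (x n)).

Definition nbounded (x : nat -> V) := exists C : R, forall n, nbd L (x n) C.

Lemma null_bounded (u : nat -> R) : null u -> exists B : R, forall n, `|u n| <= B.
Proof.
move=> /(_ 1 ltr01)[N hN]; exists (1 + \sum_(i < N) `|u i|) => n.
case: (ltnP n N) => [nN|/hN h]; last by apply: le_trans h _; rewrite lerDl sumr_ge0.
rewrite (bigD1 (Ordinal nN)) //= addrCA lerDl addr_ge0 // sumr_ge0 //.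
Qed.

End UniformBoundedness.

Lemma dual_ptw_nbounded (R : realType) (V : lmodType R) (L : nlat V) (f : nat -> dual L) :
  (forall x, null (fun n => f n x)) -> nbounded (dual_nlat L) f.
Proof.
move=> h; have [|x|C C0 hC] := @uniform_bounded _ _ L (fun n => dfun (f n)).
- by move=> n; apply: dualP.
- exact: null_bounded.
- by exists C => n; split=> // x K; apply: hC.
Qed.

(** The canonical embedding into the bidual; through it, weakly null sequences of functionals are
    pointwise null. *)
Lemma eval_bdd (R : realType) (V : lmodType R) (L : nlat V) (x : V) :
  bdd (dual_nlat L) (fun f : dual L => f x).
Proof.
split=> [a f g //|]; have [K hK] := nbd_ex L x; exists K => f M [M0 /(_ _ _ hK)].
by rewrite mulrC.
Qed.
Arguments eval_bdd {R V} L x.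

Lemma dual_wnull_nbounded (R : realType) (V : lmodType R) (L : nlat V) (f : nat -> dual L) :
  wnull (dual_nlat L) f -> nbounded (dual_nlat L) f.
Proof. by move=> h; apply: dual_ptw_nbounded => x; apply: (h _ (eval_bdd L x)). Qed.

(** * Banach lattices as instances, and boundedness of weakly null sequences *)

Section BanachLattice.
Variables (R : realType) (E : completeNormedModType R) (LE : banach_lattice_on E).

Definition bl_nlat : nlat E.
Proof.
refine (@NLat R E (ble LE) (bjoin LE) (fun x M => `|x| <= M) _ _ _ _ _ _ _ _ _ _ _ _ _ _ _ _).
- exact: ble_refl.
- exact: ble_trans.
- exact: ble_anti.
- exact: ble_add.
- exact: ble_scale.
- exact: bjoin_ubl.
- exact: bjoin_ubr.
- exact: bjoin_lub.
- by move=> x; exists `|x|.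
- by move=> x M; apply: le_trans.
- by move=> x M M'; apply: le_trans.
- by move=> a x M h; rewrite normrZ ler_wpM2l.
- by move=> x y M M' h h'; apply: le_trans (ler_normD _ _) (lerD h h').
- move=> x h; apply/eqP; rewrite -normr_eq0 eq_le normr_ge0 andbT.
  by apply/ler_addgt0Pr => e e0; rewrite add0r h.
- by move=> x y M h; apply: le_trans; apply: bnorm_mono h.
- move=> x h; have [n|l hl] := @geometric_cvg R E x 1 ler01; first by rewrite mul1r.
  by exists l => n; have := hl n; rewrite mulr1.
Defined.

Lemma in_dualP (f : E -> R) : in_dual f <-> bdd bl_nlat f.
Proof.
split=> -[lf [C hC]]; split=> //; last by exists C => x; apply: hC => /=.
exists `|C| => x M hM; apply: le_trans (hC x) _.
apply: le_trans (ler_wpM2r (normr_ge0 x) (ler_norm C)) _.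
exact: ler_wpM2l.
Qed.

Lemma weakly_nullP (x : nat -> E) : weakly_null x <-> wnull bl_nlat x.
Proof.
split=> h f hf; first by apply/nullP/h/in_dualP.
by apply/nullP/h/in_dualP.
Qed.

(** Evaluations at the [x n] are pointwise bounded on the dual, hence uniformly bounded there;
    norming functionals bring the bound back to the norms. *)
Lemma wnull_nbounded (x : nat -> E) : wnull bl_nlat x -> nbounded bl_nlat x.
Proof.
move=> hx.
have [n|f|C C0 hC] := @uniform_bounded _ _ (dual_nlat bl_nlat)
  (fun n (f : dual bl_nlat) => f (x n)).
- exact: eval_bdd.
- by apply: null_bounded; apply: hx; apply: dualP.
exists C => n /=; have [f [lf hf fx]] := norming_functional (x n).
have bf : bdd bl_nlat f.
  by split=> //; exists 1 => y M hM; rewrite mul1r; apply: le_trans (hf y) hM.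
have := hC n (Dual bf) 1; rewrite mulr1 /= fx normr_id; apply.
by split=> //= y K hK; rewrite mul1r; apply: le_trans (hf y) hK.
Qed.

End BanachLattice.

(** * Disjoint sequences in solid hulls *)

Section Projection.
Variables (R : realType) (V : lmodType R) (L : nlat V).
Implicit Types (x y z u : V) (phi : V -> R).

Local Notation "x <<= y" := (rle L x y) (at level 70, no associativity).
Local Notation meet := (rmeet L).

(* the component of phi carried by the principal ideal of u *)
Definition carrier_pos phi u x : R :=
  sup [set r | exists k : nat, r = phi (meet x (k%:R *: u))].
Definition carrier phi u : V -> R := pext L (carrier_pos phi u).

Variables (phi : V -> R) (u : V).
Hypotheses (lphi : lin phi) (pphi : posf L phi) (u0 : 0 <<= u).

Let ku_ge0 (k : nat) : 0 <<= k%:R *: u. Proof. exact: rscale_ge0. Qed.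

Let meet_ku_le x (k : nat) : phi (meet x (k%:R *: u)) <= phi x.
Proof. by apply: (posf_le lphi pphi); apply: rmeet_lbl. Qed.

Lemma carrier_pos_ge x (k : nat) : phi (meet x (k%:R *: u)) <= carrier_pos phi u x.
Proof. by apply: (@le_sup_of _ _ (phi x)) => [r [j ->] //|]; exists k. Qed.

Lemma carrier_pos_le x (b : R) :
  (forall k : nat, phi (meet x (k%:R *: u)) <= b) -> carrier_pos phi u x <= b.
Proof.
move=> h; apply: (@sup_le_of _ _ b (phi (meet x (0%:R *: u)))); first by exists 0%N.
by move=> r [k ->].
Qed.

Lemma carrier_pos_ge0 x : 0 <<= x -> 0 <= carrier_pos phi u x.
Proof.
move=> x0; apply: le_trans (carrier_pos_ge x 0); apply: pphi.
exact: rmeet_ge0.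
Qed.

Lemma carrier_pos_add x y : 0 <<= x -> 0 <<= y ->
  carrier_pos phi u (x + y) = carrier_pos phi u x + carrier_pos phi u y.
Proof.
move=> x0 y0; apply/eqP; rewrite eq_le; apply/andP; split.
  apply: carrier_pos_le => k.
  apply: le_trans (posf_le lphi pphi (rmeet_addl x0 y0 (ku_ge0 k))) _.
  by rewrite (linD lphi); apply: lerD; apply: carrier_pos_ge.
rewrite -lerBrDr; apply: carrier_pos_le => k.
rewrite lerBrDl -lerBrDr; apply: carrier_pos_le => j.
(* Multiples [k] and [j] are absorbed together by the multiple [k + j]. *)
rewrite lerBrDl -(linD lphi); apply: le_trans (carrier_pos_ge _ (k + j)).
apply: (posf_le lphi pphi); apply: rmeet_glb.
  by apply: rleD; apply: rmeet_lbl.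
by rewrite natrD scalerDl; apply: rleD; apply: rmeet_lbr.
Qed.

Lemma carrier_lin : lin (carrier phi u).
Proof. exact: pext_lin carrier_pos_add carrier_pos_ge0. Qed.

Lemma carrier_posf : posf L (carrier phi u).
Proof. exact: pext_pos carrier_pos_add carrier_pos_ge0. Qed.

Lemma carrierE x : 0 <<= x -> carrier phi u x = carrier_pos phi u x.
Proof. exact: pext_cone carrier_pos_add x. Qed.

Lemma carrier_ge x : 0 <<= x -> phi (meet x u) <= carrier phi u x.
Proof. by move=> x0; rewrite carrierE //; have := carrier_pos_ge x 1; rewrite scale1r. Qed.

Lemma carrier_disj x : 0 <<= x -> meet x u = 0 -> carrier phi u x = 0.
Proof.
move=> x0 h; apply/eqP; rewrite eq_le carrier_posf // andbT carrierE //.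
apply: carrier_pos_le => k; rewrite rmeetC rdisj_nat //; last by rewrite rmeetC.
by rewrite (lin0 lphi).
Qed.

End Projection.

Section DisjointWeaklyNull.
Variables (R : realType) (V : lmodType R) (L : nlat V).
Implicit Types (x y z u : V) (phi : V -> R).

Local Notation "x <<= y" := (rle L x y) (at level 70, no associativity).
Local Notation meet := (rmeet L).
Local Notation abs := (rabs L).
Local Notation pos := (rpos L).

Definition disj_seq (x : nat -> V) :=
  forall n m, n <> m -> meet (abs (x n)) (abs (x m)) = 0.

(** A finite sum of suprema is controlled by independent choices of one element in each set. *)
Lemma sum_sup_le (S : nat -> set R) n (b : R) : (forall i, exists r, S i r) ->
  (forall r : nat -> R, (forall i, S i (r i)) -> \sum_(i < n) r i <= b) ->
  \sum_(i < n) sup (S i) <= b.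
Proof.
move=> ne; elim: n b => [|n IHn] b h.
  have /choice[r hr] := ne; by have := h r hr; rewrite !big_ord0.
rewrite big_ord_recr /= -lerBrDl; have [s0 hs0] := ne n.
apply: (sup_le_of hs0) => s hs; rewrite lerBrDl -lerBrDr; apply: IHn => r hr.
have := h (fun i => if i == n then s else r i); rewrite big_ord_recr /= eqxx lerBrDr.
move=> /(_ _) h'; apply: le_trans (h' _); last by move=> i; case: eqP => [->|].
rewrite lerD2r; apply: ler_sum => i _; case: eqP => // e.
by have := ltn_ord i; rewrite e ltnn.
Qed.

(** For any multiples [k i], the meets of [x] with the vectors [k i *: a i] are disjoint and below
    [x], so their sum is below [x]. *)
Lemma carrier_sum_le phi (a : nat -> V) x n : lin phi -> posf L phi ->
  (forall i, 0 <<= a i) -> (forall i j, i <> j -> meet (a i) (a j) = 0) ->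
  0 <<= x -> \sum_(i < n) carrier L phi (a i) x <= phi x.
Proof.
move=> lphi pphi a0 da x0.
rewrite (eq_bigr (fun i : 'I_n => carrier_pos L phi (a i) x)); last first.
  by move=> i _; apply: carrierE.
apply: (@sum_sup_le (fun i => [set r | exists k : nat, r = phi (meet x (k%:R *: a i))]))
  => [i|r hr]; first by exists (phi (meet x (0%:R *: a i))), 0%N.
have /choice[k hk] := hr.
rewrite (eq_bigr (fun i : 'I_n => phi (meet x ((k i)%:R *: a i)))); last by move=> i _.
have ka0 i : 0 <<= (k i)%:R *: a i by apply: rscale_ge0.
rewrite -(lin_sum lphi (fun i => meet x ((k i)%:R *: a i))).
apply: (posf_le lphi pphi).
apply: (@rsum_disj _ _ _ (fun i => meet x ((k i)%:R *: a i))) => //.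
- by move=> i; apply: rmeet_ge0.
- by move=> i; apply: rmeet_lbl.
- move=> i j ij.
  have h : meet ((k i)%:R *: a i) ((k j)%:R *: a j) = 0.
    by apply: rdisj_nat => //; rewrite rmeetC; apply: rdisj_nat => //; apply: da => /esym.
  by apply: (rdisj_le h); do ?[exact: rmeet_ge0 | exact: rmeet_lbr].
Qed.

(** * Gliding hump for series of positive functionals *)

Section Hump.
Variables (psi : nat -> V -> R) (phi : V -> R).
Hypotheses (lpsi : forall k, lin (psi k)) (ppsi : forall k, posf L (psi k)).
Hypotheses (lphi : lin phi).
Hypothesis sum_le : forall x n, 0 <<= x -> \sum_(k < n) psi k x <= phi x.

Lemma subsum_le (t : nat -> nat) x n : str_incr t -> 0 <<= x ->
  \sum_(k < n) psi (t k) x <= phi x.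
Proof.
move=> ht x0; apply: le_trans (sum_le (t n) x0).
elim: n => [|n IHn].
  by rewrite big_ord0 sumr_ge0 // => i _; apply: ppsi.
rewrite big_ord_recr /=; apply: le_trans (lerD IHn (lexx _)) _.
have le1 : ((t n).+1 <= t n.+1)%N by apply: ht.
rewrite -!(big_mkord xpredT (fun k => psi k x)) (big_cat_nat (leq0n _) le1) //=.
by rewrite big_nat_recr //= lerDl sumr_ge0 // => i _; apply: ppsi.
Qed.

Definition subseries_pos (t : nat -> nat) x : R :=
  sup [set r | exists n : nat, r = \sum_(k < n) psi (t k) x].

(** The sum of the [psi] along a subsequence is again a positive functional, hence a bounded one,
    against which a weakly null sequence can be tested. *)
Lemma subseriesP (t : nat -> nat) : str_incr t ->
  let Psi := pext L (subseries_pos t) in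
  [/\ lin Psi, posf L Psi &
    forall x, 0 <<= x -> (forall n, \sum_(k < n) psi (t k) x <= Psi x) /\
      (forall b, (forall n, \sum_(k < n) psi (t k) x <= b) -> Psi x <= b)].
Proof.
move=> ht Psi; pose p := subseries_pos t.
have mono x n m : 0 <<= x -> (n <= m)%N ->
    \sum_(k < n) psi (t k) x <= \sum_(k < m) psi (t k) x.
  move=> x0 nm; rewrite -!(big_mkord xpredT (fun k => psi (t k) x)).
  rewrite (big_cat_nat (leq0n _) nm) //=.
  by rewrite lerDl sumr_ge0 // => i _; apply: ppsi.
have ge x n : 0 <<= x -> \sum_(k < n) psi (t k) x <= p x.
  move=> x0; apply: (@le_sup_of _ _ (phi x)); last by exists n.
  by move=> r [m ->]; apply: subsum_le.
have le x b : (forall n, \sum_(k < n) psi (t k) x <= b) -> p x <= b.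
  move=> h; apply: (@sup_le_of _ _ b (\sum_(k < 0) psi (t k) x)); first by exists 0%N.
  by move=> r [n ->].
have pge0 x : 0 <<= x -> 0 <= p x by move=> x0; have := ge x 0%N x0; rewrite big_ord0.
have sumD x y n : \sum_(k < n) psi (t k) (x + y) =
    \sum_(k < n) psi (t k) x + \sum_(k < n) psi (t k) y.
  by rewrite -big_split; apply: eq_bigr => i _; apply: linD.
have pD x y : 0 <<= x -> 0 <<= y -> p (x + y) = p x + p y.
  move=> x0 y0; apply/eqP; rewrite eq_le; apply/andP; split.
    by apply: (le) => n; rewrite sumD; apply: lerD; apply: ge.
  rewrite -lerBrDr; apply: (le) => n; rewrite lerBrDl -lerBrDr; apply: (le) => m.
  rewrite lerBrDl; apply: le_trans (ge _ (maxn n m) (radd_ge0 x0 y0)); rewrite sumD.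
  by apply: lerD; apply: mono => //; rewrite (leq_maxl, leq_maxr).
split; [exact: pext_lin|exact: pext_pos|move=> x x0].
by rewrite /Psi pext_cone //; split=> [n|b]; [apply: ge|apply: le].
Qed.

(** [K] is taken from the full series. It serves every [t], since a tail along [t] consists of some
    terms of the full tail. *)
Lemma psi_tail x (e : R) : 0 <<= x -> 0 < e ->
  exists K, forall t n m, str_incr t -> (K <= t n)%N ->
    \sum_(n <= k < m) psi (t k) x <= e.
Proof.
move=> x0 e0; pose S := [set r | exists n : nat, r = \sum_(k < n) psi k x].
have hS : has_sup S.
  split; first by exists (\sum_(k < 0) psi k x), 0%N.
  by exists (phi x) => r [n ->]; apply: sum_le.
have [r [K ->] hK] := @sup_adherent R S e e0 hS.
exists K => t n m ht Kn.
have step j : \sum_(n <= k < n + j) psi (t k) x <= \sum_(t n <= k < t (n + j)%N) psi k x.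
  elim: j => [|j IHj]; first by rewrite addn0 !big_geq.
  have le1 : ((t (n + j)).+1 <= t (n + j).+1)%N by apply: ht.
  have le2 : (t n <= t (n + j))%N.
    by case: j {IHj le1} => [|j]; rewrite ?addn0 // ltnW // str_incr_lt // addnS ltnS leq_addr.
  rewrite addnS big_nat_recr ?leq_addr //=.
  rewrite (big_cat_nat (leqW le2) le1) //=.
  rewrite big_nat_recr //=.
  have : 0 <= \sum_((t (n + j)).+1 <= i < t (n + j).+1) psi i x.
    by apply: sumr_ge0 => i _; apply: ppsi.
  lra.
case: (leqP m n) => [mn|/ltnW nm]; first by rewrite big_geq // ltW.
rewrite -(subnKC nm); apply: le_trans (step _) _; rewrite (subnKC nm).
have tnm : (t n <= t m)%N.
  by move: nm; rewrite leq_eqVlt => /orP[/eqP ->//|h]; rewrite ltnW // str_incr_lt.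
have : \sum_(k < t m) psi k x <= sup S.
  by apply: (sup_upper_bound hS); exists (t m).
rewrite -!(big_mkord xpredT (fun k => psi k x)) in hK *.
rewrite (big_cat_nat (leq0n _) tnm) //= (big_cat_nat (leq0n _) Kn) //=.
have : 0 <= \sum_(K <= i < t n) psi i x by apply: sumr_ge0 => i _; apply: ppsi.
lra.
Qed.

(* Schur's theorem for the l^1-valued operator x |-> (psi_k x)_k. *)
Lemma hump (x : nat -> V) (e : R) : wnull L x -> 0 < e ->
  exists N, forall n, (N <= n)%N -> psi n (x n) <= e.
Proof.
move=> wx e0; apply: contrapT => /forallNP hN.
have freq N : exists n, (N <= n)%N /\ e < psi n (x n).
  have /existsNP[n /not_implyP[nN /negP]] := hN N.
  by rewrite -ltNge => hn; exists n.
have e4 : 0 < e / 4 by lra.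
have /choice[K hK] : forall j, exists K, forall t n m, str_incr t -> (K <= t n)%N ->
    \sum_(n <= k < m) psi (t k) (abs (x j)) <= e / 4.
  by move=> j; apply: psi_tail => //; apply: rabs_ge0.
have head m : exists N, forall n, (N <= n)%N -> \sum_(k < m) `|psi k (x n)| <= e / 4.
  have h : null (fun n => \sum_(k < m) `|psi k (x n)|).
    elim: m => [|m IHm].
      by move=> d d0; exists 0%N => n _; rewrite big_ord0 normr0 ltW.
    have hm : null (fun n => `|psi m (x n)|).
      have := wx _ (posf_bdd (lpsi m) (@ppsi m)); move=> hw d d0.
      by have [N hN'] := hw d d0; exists N => n nN; rewrite normr_id; apply: hN'.
    have := nullD IHm hm; congr null; apply/funext => n.
    by rewrite big_ord_recr.
  by have [N hN'] := h _ e4; exists N => n nN; apply: le_trans (ler_norm _) (hN' n nN).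
have /choice[H hH] := head.
(* The next index lies beyond [j], so far out that the later functionals are small on [abs (x j)],
   and that the functionals up to index [j] are small on the next vector. *)
have /choice[next hnext] : forall j, exists n,
    (maxn j.+1 (maxn (K j) (H j.+1)) <= n)%N /\ e < psi n (x n).
  by move=> j; apply: freq.
pose t := fix t j := if j is i.+1 then next (t i) else next 0%N.
have tP j : e < psi (t j) (x (t j)) by case: j => [|j]; apply: (hnext _).2.
have tS j : [/\ (t j < t j.+1)%N, (K (t j) <= t j.+1)%N & (H (t j).+1 <= t j.+1)%N].
  by have := (hnext (t j)).1; rewrite !geq_max => /and3P.
have ht : str_incr t by move=> j; have [] := tS j.
have [lP pP PP] := subseriesP ht; set Psi := pext L _ in lP pP PP.
have bP : bdd L Psi by apply: posf_bdd.
(* At [y] the head and the tail of the series each cost [e / 4] and the diagonal term exceeds [e],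
   so [Psi y] exceeds [e / 2], against [e / 8]. *)
have [N hPN] := wx _ bP (e / 8) ltac:(lra).
(* A successor, so that the conditions imposed when [t j] was chosen after [t N] are available. *)
pose j := N.+1.
have tj : (N <= t j)%N by apply: leq_trans (leqnSn N) (str_incr_ge j ht).
have := hPN _ tj.
pose y := x (t j).
have tail z : 0 <<= z -> z <<= abs y ->
    Psi z <= \sum_(k < j.+1) psi (t k) z + e / 4.
  move=> z0 zy; apply: (PP _ z0).2 => n.
  apply: (@le_trans _ _ (\sum_(k < j.+1 + n) psi (t k) z)).
    rewrite -!(big_mkord xpredT (fun k => psi (t k) z)).
    rewrite (big_cat_nat (leq0n n) (leq_addl j.+1 n)) //= lerDl.
    by apply: sumr_ge0 => i _; apply: ppsi.
  rewrite -!(big_mkord xpredT (fun k => psi (t k) z)).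
  rewrite (big_cat_nat (leq0n j.+1) (leq_addr n j.+1)) //= lerD2l.
  apply: le_trans (hK (t j) t j.+1 _ ht _); last by have [] := tS j.
  by apply: ler_sum => k _; apply: (posf_le (lpsi _) (@ppsi _)).
(* Psi (x_{t_j}) is the diagonal term up to e/2 *)
have hpos := (PP _ (rpos_ge0 L y)).1 j.+1.
have hneg := tail _ (rpos_ge0 L (- y)) (rneg_le_abs L y).
have hsum : \sum_(k < j.+1) psi (t k) y - e / 4 <= Psi y.
  rewrite {2}(rposB L y) (linB lP).
  have -> : \sum_(k < j.+1) psi (t k) y =
      \sum_(k < j.+1) psi (t k) (pos y) - \sum_(k < j.+1) psi (t k) (pos (- y)).
    rewrite -sumrB; apply: eq_bigr => k _.
    by rewrite {1}(rposB L y) (linB (lpsi _)).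
  lra.
have hj := tP j; rewrite -/y in hj.
rewrite big_ord_recr /= in hsum.
have hhead : `|\sum_(k < j) psi (t k) y| <= e / 4.
  have [_ _ hHj] := tS N.
  apply: le_trans (ler_norm_sum _ _ _) _; apply: le_trans (hH (t N).+1 _ hHj).
  have : forall m, (m <= N)%N ->
      \sum_(k < m.+1) `|psi (t k) y| <= \sum_(k < (t m).+1) `|psi k y|; last exact.
  elim=> [_|m IHm mN].
    by rewrite big_ord1 big_ord_recr /= lerDr sumr_ge0.
  rewrite big_ord_recr /= [X in _ <= X]big_ord_recr /= lerD2r.
  apply: le_trans (IHm (ltnW mN)) _.
  rewrite -!(big_mkord xpredT (fun k => `|psi k y|)).
  by rewrite (big_cat_nat (leq0n _) (ht m)) //= lerDl sumr_ge0.
rewrite -/y ler_norml => /andP[_ hle].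
move: hhead; rewrite ler_norml => /andP[hh _]; lra.
Qed.

End Hump.

(** The hump is applied to the carriers of [phi] at the [a n]. The negative part of [x n] is
    disjoint from [a n], so the carrier ignores it and its value at [x n] is at least
    [phi (a n)]. *)
Lemma disj_pos_part_null (x a : nat -> V) phi : wnull L x -> lin phi -> posf L phi ->
  (forall n, 0 <<= a n) -> (forall n, a n <<= pos (x n)) ->
  (forall i j, i <> j -> meet (a i) (a j) = 0) -> null (fun n => phi (a n)).
Proof.
move=> wx lphi pphi a0 ax da e e0.
have lc k := carrier_lin lphi pphi (a0 k).
have pc k := carrier_posf lphi pphi (a0 k).
have hsum y n : 0 <<= y -> \sum_(k < n) carrier L phi (a k) y <= phi y.
  by move=> y0; apply: carrier_sum_le.
have [N hN] := hump lc pc hsum wx e0.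
exists N => n nN; rewrite ger0_norm; last exact: pphi.
apply: le_trans (hN n nN).
rewrite [X in carrier _ _ _ X](rposB L (x n)) (linB (lc n)).
rewrite (carrier_disj lphi pphi (a0 n) (rpos_ge0 L (- x n))) ?subr0; last first.
  have := rpos_disj L (x n); rewrite rmeetC => h.
  by apply: (rdisj_le h); do ?[exact: rpos_ge0 | exact: rle_refl | exact: a0 | exact: ax].
apply: le_trans (carrier_ge lphi pphi (a0 n) (rpos_ge0 _ _)).
by rewrite rmeetC rmeet_idl.
Qed.

(** Meeting [abs (y n)] with the positive and the negative part of [x n] gives two disjoint
    sequences to which the preceding lemma applies, for [x] and for [- x]; their sum dominates
    [abs (y n)]. *)
Theorem disj_solid_wnull (x y : nat -> V) : wnull L x -> disj_seq y ->
  (forall n, abs (y n) <<= abs (x n)) -> wnull L y.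
Proof.
move=> wx dy yx psi bpsi.
have bphi := dabs_bdd bpsi; have lphi := bphi.1; have pphi := dabs_posf bpsi.
set phi := dabs L psi in bphi lphi pphi.
apply: (@null_le _ _ (fun n => phi (abs (y n)))); last first.
  by move=> n; apply: (dabs_ge bpsi); apply: rle_refl.
have wNx : wnull L (fun n => - x n).
  move=> f bf; have := nullZ (-1) (wx f bf); congr null; apply/funext => n.
  by rewrite (linN bf.1) mulN1r.
pose a n := meet (abs (y n)) (pos (x n)).
pose b n := meet (abs (y n)) (pos (- x n)).
have a0 n : 0 <<= a n by apply: rmeet_ge0; [apply: rabs_ge0|apply: rpos_ge0].
have b0 n : 0 <<= b n by apply: rmeet_ge0; [apply: rabs_ge0|apply: rpos_ge0].
have na : null (fun n => phi (a n)).
  apply: (disj_pos_part_null wx) => // [n|i j /dy h]; first exact: rmeet_lbr.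
  by apply: (rdisj_le h) => //; apply: rmeet_lbl.
have nb : null (fun n => phi (b n)).
  apply: (disj_pos_part_null wNx) => // [n|i j /dy h]; first exact: rmeet_lbr.
  by apply: (rdisj_le h) => //; apply: rmeet_lbl.
apply: (null_le (nullD na nb)) => n.
rewrite ger0_norm; last by apply: pphi; apply: rabs_ge0.
rewrite -(linD lphi); apply: (posf_le lphi pphi).
have := rmeet_addl (rpos_ge0 L (x n)) (rpos_ge0 L (- x n)) (rabs_ge0 L (y n)).
rewrite -rabsE (rmeetC L (abs (x n))) rmeet_idl //.
by rewrite (rmeetC L (pos (x n))) (rmeetC L (pos (- x n))).
Qed.

End DisjointWeaklyNull.

(** * Disjointification *)

Section Disjointification.
Variables (R : realType) (V : lmodType R) (L : nlat V).

Local Notation "x <<= y" := (rle L x y) (at level 70, no associativity).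
Local Notation meet := (rmeet L).
Local Notation abs := (rabs L).
Local Notation pos := (rpos L).
Local Ltac mring := lazymatch goal with |- ?a = ?b => lmod_of R V a b end.

Lemma nbounded_dominated (x : nat -> V) : nbounded L x ->
  exists w, 0 <<= w /\ forall n, 4^-1 ^+ n *: abs (x n) <<= w.
Proof.
move=> [C hC]; have C0 := nbd_ge0 (hC 0%N).
have C1 : 0 < C + 1 by lra.
have q0 n : 0 <= 4^-1 ^+ n :> R by rewrite exprn_ge0 // invr_ge0.
have [n|w [w0 hw]] := @nbd_dominated _ _ L (fun n => (4^-1 ^+ n / (C + 1)) *: abs (x n)).
  have := nbdZ (4^-1 ^+ n / (C + 1)) (nbd_abs (hC n)) => /nbd_le; apply.
  rewrite ger0_norm ?divr_ge0 ?(ltW C1) // mulrAC ler_pdivrMr //.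
  by apply: ler_wpM2l => //; lra.
exists ((C + 1) *: w); split; first by apply: rscale_ge0 => //; apply: ltW.
move=> n; have := rle_scale (ltW C1) (hw n); rewrite rabs_id; last first.
  by apply: rscale_ge0 (rabs_ge0 _ _); rewrite divr_ge0 // ltW.
by rewrite scalerA mulrC divfK // gt_eqF.
Qed.

(** With [d = a - t^-1 *: b], the second vector is [t] times the negative part of [d]. *)
Lemma scaled_diff_disj (t : R) a b : 0 < t ->
  meet (pos (a - t^-1 *: b)) (pos (b - t *: a)) = 0.
Proof.
move=> t0; set d := a - t^-1 *: b.
have h : pos (b - t *: a) = t *: pos (- d).
  have e1 : b - t *: a = t *: - d.
    rewrite /d opprB scalerBr scalerA divff ?gt_eqF // scale1r; by [].
  apply: (@rle_anti _ _ L).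
    apply: rjoin_lub; last by apply: rscale_ge0 (rpos_ge0 _ _); apply: ltW.
    by rewrite e1; apply: rle_scale; [apply: ltW|apply: rpos_ge].
  suff h2 : pos (- d) <<= t^-1 *: pos (b - t *: a).
    by have := rle_scale (ltW t0) h2; rewrite scalerA divff ?gt_eqF // scale1r.
  apply: rjoin_lub; last by apply: rscale_ge0 (rpos_ge0 _ _); rewrite invr_ge0 ltW.
  have -> : - d = t^-1 *: (b - t *: a).
    by rewrite e1 scalerA mulVf ?gt_eqF // scale1r.
  by apply: rle_scale; [rewrite invr_ge0 ltW|apply: rpos_ge].
rewrite h rmeetC; apply: rdisj_scale; do ?[exact: rpos_ge0 | exact: ltW].
by rewrite rmeetC rpos_disj.
Qed.

(** [y j] is the positive part of [X (s j) - 4^j z j - w], where [z j] sums the earlier chosen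
    moduli and [w] dominates all [4^-j X (s j)]. Subtracting [z j] and [w] puts [y i] and [y j]
    under the two vectors of [scaled_diff_disj] with [t = 4^j]. *)
Theorem disjointification (x : nat -> V) (rho : nat -> V -> R) :
  nbounded L x -> (forall n, lin (rho n)) -> (forall n, posf L (rho n)) ->
  (forall z, 0 <<= z -> null (fun n => rho n z)) ->
  exists s y, [/\ str_incr s, forall j, 0 <<= y j, forall j, y j <<= abs (x (s j)),
    forall i j, i <> j -> meet (y i) (y j) = 0 &
    null (fun j => rho (s j) (abs (x (s j)) - y j))].
Proof.
move=> bx lr pr nr; pose X n := abs (x n).
have X0 n : 0 <<= X n by apply: rabs_ge0.
(* The choice function must be total: for [z] outside the cone the successor index is returned. *)
have /choice[G hG] : forall q : nat * V * nat, exists n, (q.1.1 < n)%N /\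
    (0 <<= q.1.2 -> rho n (4 ^+ q.2 *: q.1.2) <= 4^-1 ^+ q.2).
  move=> [[m z] j] /=; have [z0|nz] := pselect (0 <<= z); last by exists m.+1; split.
  have q0 : 0 < 4^-1 ^+ j :> R by rewrite exprn_gt0 // invr_gt0.
  have zz : 0 <<= 4 ^+ j *: z by apply: rscale_ge0 => //; rewrite exprn_ge0.
  have [N hN] := nr _ zz _ q0.
  exists (maxn N m.+1); split; first by rewrite leq_max leqnn orbT.
  by move=> _; apply: le_trans (ler_norm _) (hN _ _); rewrite leq_maxl.
(* The state holds the last index and the sum of the moduli chosen so far. The starting index [0] is
   not part of [s], hence the shift in its definition. *)
pose st := fix st j : nat * V :=
  if j is i.+1 then let n := G (st i, i) in (n, (st i).2 + X n) else (0%N, 0).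
pose s j := (st j.+1).1; pose z j := (st j).2.
have zS j : z j.+1 = z j + X (s j) by [].
have zsum j : z j = \sum_(i < j) X (s i).
  elim: j => [|j IHj]; first by rewrite big_ord0.
  by rewrite zS IHj (rsum_recr (fun i => X (s i))).
have z0 j : 0 <<= z j by rewrite zsum; apply: (@rsum_ge0 _ _ _ (fun i => X (s i))).
have zge i j : (i < j)%N -> X (s i) <<= z j.
  by move=> ij; rewrite zsum; apply: (@rsum_ge _ _ _ (fun i => X (s i))).
have hs : str_incr s by move=> j; apply: (hG (st j.+1, j.+1)).1.
have rs j : rho (s j) (4 ^+ j *: z j) <= 4^-1 ^+ j by apply: (hG (st j, j)).2; apply: z0.
have bxs : nbounded L (fun j => x (s j)) by have [C hC] := bx; exists C.
have [w [w0 hw]] := nbounded_dominated bxs.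
pose v j := 4 ^+ j *: z j + w; pose y j := pos (X (s j) - v j).
have v0 j : 0 <<= v j by apply: radd_ge0 => //; apply: rscale_ge0 => //; rewrite exprn_ge0.
have dis i j : (i < j)%N -> meet (y i) (y j) = 0.
  move=> ij; have t0 : 0 < 4 ^+ j :> R by rewrite exprn_gt0.
  apply: (rdisj_le (scaled_diff_disj (X (s i)) (X (s j)) t0)); do ?exact: rpos_ge0.
    apply: rpos_le; have hj := hw j; rewrite exprVn in hj.
    have zi : 0 <<= 4 ^+ i *: z i by apply: rscale_ge0 => //; rewrite exprn_ge0.
    by apply: (rle_by2 hj zi); rewrite /v /X; mring.
  apply: rpos_le; have h := rle_scale (ltW t0) (zge _ _ ij).
  by apply: (rle_by2 h w0); rewrite /v /X; mring.
exists s, y; split=> //.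
- by move=> j; apply: rpos_ge0.
- move=> j; apply: rjoin_lub; last exact: X0.
  by apply: (rle_by1 (v0 j)); rewrite /X; mring.
- move=> i j ij; case: (ltngtP i j) => [||//]; first exact: dis.
  by move=> ji; rewrite rmeetC; apply: dis.
- have nq : null (fun j => 1 * (4^-1 : R) ^+ j) by apply: null_geom; apply/andP; split; lra.
  have nw := null_subseq hs (nr _ w0).
  apply: (null_le (nullD nq nw)) => j.
  have ge0 : 0 <<= X (s j) - y j.
    apply: (rle_subl _ _ _).1; apply: rjoin_lub; last exact: X0.
    by apply: (rle_by1 (v0 j)); mring.
  rewrite ger0_norm; last exact: pr.
  apply: le_trans (_ : rho (s j) (v j) <= _); last first.
    by rewrite /v (linD (lr _)) mul1r lerD2r.
  apply: (posf_le (lr _) (@pr _)).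
  have h := rpos_ge L (X (s j) - v j).
  by apply: (rle_by1 h); rewrite -/(y j) /X; mring.
Qed.

(** Along a subsequence [x] splits as [h + k], with [h] dominated by the disjoint vectors and [k] by
    the remainder. Then [h] is weakly null by solidity and is left to the test, while [rho] controls
    [a] on [k]. *)
Theorem disjoint_test (x : nat -> V) (a rho : nat -> V -> R) :
  wnull L x -> nbounded L x ->
  (forall n, lin (a n)) ->
  (forall n, lin (rho n)) -> (forall n, posf L (rho n)) ->
  (forall n k, `|a n k| <= rho n (abs k)) ->
  (forall z, 0 <<= z -> null (fun n => rho n z)) ->
  (forall s h, str_incr s -> disj_seq L h -> wnull L h ->
     (forall j, abs (h j) <<= abs (x (s j))) -> null (fun j => a (s j) (h j))) ->
  null (fun n => a n (x n)).
Proof.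
move=> wx bx la lr pr ar nr test; apply: null_subsub => t ht.
have [|s [y [hs y0 yx dy ny]]] := @disjointification (fun n => x (t n)) (fun n => rho (t n)) _
  (fun n => lr _) (fun n => @pr _) (fun z z0 => null_subseq ht (nr z z0)).
  by have [C hC] := bx; exists C.
exists s => //.
have hts : str_incr (fun j => t (s j)).
  by move=> j; apply: str_incr_lt.
have /choice[hk hhk] : forall j, exists hk : V * V,
    [/\ x (t (s j)) = hk.1 + hk.2, abs hk.1 <<= y j
      & abs hk.2 <<= abs (x (t (s j))) - y j].
  move=> j; have d0 : 0 <<= abs (x (t (s j))) - y j by apply: (rle_subl _ _ _).1.
  have [|h [k [e1 e2 e3]]] := @riesz_dec_abs _ _ L (x (t (s j))) _ _ _ (y0 j) d0.
    by apply: rle_eq; mring.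
  by exists (h, k).
pose h j := (hk j).1; pose k j := (hk j).2.
have hy j : abs (h j) <<= y j by have [] := hhk j.
have hx j : abs (h j) <<= abs (x (t (s j))) by apply: rle_trans (hy j) (yx j).
have dh : disj_seq L h.
  by move=> i j ij; apply: (rdisj_le (dy i j ij)) => //; apply: rabs_ge0.
have wh : wnull L h.
  apply: (disj_solid_wnull (x := fun j => x (t (s j)))) => // f bf.
  exact: (null_subseq hts (wx f bf)).
have nh := test _ _ hts dh wh hx.
have nk : null (fun j => a (t (s j)) (k j)).
  apply: (null_le ny) => j; apply: le_trans (ar _ _) _.
  by apply: (posf_le (lr _) (@pr _)); have [] := hhk j.
have := nullD nh nk; congr null; apply/funext => j.
by have [-> _ _] := hhk j; rewrite (linD (la _)).
Qed.

End Disjointification.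

(** * Order bounded operators *)

Section OrderBounded.
Variables (R : realType) (V W : lmodType R) (L : nlat V) (M : nlat W).
Variable T : V -> W.

Local Notation "x <<= y" := (rle L x y) (at level 70, no associativity).
Local Notation "x <<< y" := (rle M x y) (at level 70, no associativity).
Local Ltac mring := lazymatch goal with |- ?a = ?b => lmod_of R V a b end.
Local Ltac mringW := lazymatch goal with |- ?a = ?b => lmod_of R W a b end.

Definition linop := forall (a : R) x y, T (a *: x + y) = a *: T x + T y.
Definition obop :=
  forall u, exists w, forall y, rabs L y <<= u -> rabs M (T y) <<< w.

Hypotheses (lT : linop) (oT : obop).

Lemma linopD x y : T (x + y) = T x + T y.
Proof. by have := lT 1 x y; rewrite !scale1r. Qed.

Lemma linop0 : T 0 = 0.
Proof.
have := linopD 0 0; rewrite addr0 => /(congr1 (fun v => v - T 0)).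
by rewrite subrr addrK.
Qed.

Lemma linopN x : T (- x) = - T x.
Proof. by have := lT (-1) x 0; rewrite !scaleN1r linop0 !addr0. Qed.

Lemma lin_comp f : lin f -> lin (fun x => f (T x)).
Proof. by move=> lf a x y; rewrite lT lf. Qed.

(** [f] is bounded on the order interval containing the image of an interval, and order bounded
    functionals are norm bounded. *)
Lemma comp_bdd f : bdd M f -> bdd L (fun x => f (T x)).
Proof.
move=> bf; apply: obdd_bdd; first exact: lin_comp bf.1.
move=> u; have [w hw] := oT u; have [B hB] := bdd_obdd bf w.
by exists B => y /hw /hB.
Qed.

Lemma dabs_comp_null (f : nat -> W -> R) : (forall n, bdd M (f n)) ->
  (forall w, rle M 0 w -> null (fun n => dabs M (f n) w)) ->
  forall z, 0 <<= z -> null (fun n => dabs L (fun x => f n (T x)) z).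
Proof.
move=> bf nf z z0; have [w hw] := oT z.
have w0 : 0 <<< w.
  apply: rle_trans (rabs_ge0 M (T 0)) (hw _ _); rewrite rabs0; exact: z0.
apply: (null_le (nf w w0)) => n; rewrite ger0_norm; last first.
  by apply: dabs_posf z0; apply: comp_bdd.
apply: (dabs_le (comp_bdd (bf n))) => // y /hw hy.
exact: dabs_ge.
Qed.

Fixpoint vtotal (xs : seq V) : V := if xs is x :: xs' then x + vtotal xs' else 0.
Fixpoint vall_pos (xs : seq V) : Prop :=
  if xs is x :: xs' then 0 <<= x /\ vall_pos xs' else True.
Fixpoint abs_total (xs : seq V) : W :=
  if xs is x :: xs' then rabs M (T x) + abs_total xs' else 0.

Lemma vtotal_ge0 xs : vall_pos xs -> 0 <<= vtotal xs.
Proof.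
elim: xs => [|x xs IH] /=; first by move=> _; apply: rle_refl.
by move=> [x0 /IH]; apply: radd_ge0.
Qed.

(* sum |T x_i| is the supremum over signs of T (sum +- x_i). *)
Lemma abs_total_le xs v w : vall_pos xs ->
  (forall y, rabs L y <<= vtotal xs -> v + T y <<< w) -> v + abs_total xs <<< w.
Proof.
elim: xs v => [|x xs IH] v /=.
  by move=> _ /(_ 0); rewrite linop0 rabs0; apply; apply: rle_refl.
move=> [x0 xs0] h.
suff h2 : rabs M (T x) <<< w - (v + abs_total xs) by apply: (rle_by1 h2); mringW.
apply/rabs_leP; split.
  have hx : v + T x + abs_total xs <<< w.
    apply: IH => // y hy; rewrite -addrA -linopD; apply: h.
    apply: rle_trans (rabsD _ _ _) _; rewrite rabs_id //.
    exact: rleD (rle_refl _ _) hy.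
  by apply: (rle_by1 hx); mringW.
have hx : v - T x + abs_total xs <<< w.
  apply: IH => // y hy; rewrite -addrA -linopN -linopD; apply: h.
  apply: rle_trans (rabsD _ _ _) _; rewrite rabsN rabs_id //.
  exact: rleD (rle_refl _ _) hy.
by apply: (rle_by1 hx); mringW.
Qed.

Lemma abs_total_cat xs ys : abs_total (xs ++ ys) = abs_total xs + abs_total ys.
Proof. by elim: xs => [|x xs IH] /=; rewrite ?add0r // IH addrA. Qed.

Lemma vtotal_cat xs ys : vtotal (xs ++ ys) = vtotal xs + vtotal ys.
Proof. by elim: xs => [|x xs IH] /=; rewrite ?add0r // IH addrA. Qed.

Lemma vall_pos_cat xs ys : vall_pos xs -> vall_pos ys -> vall_pos (xs ++ ys).
Proof. by elim: xs => //= x xs IH [x0 xs0] ys0; split=> //; apply: IH. Qed.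

(** Each entry is cut by Riesz decomposition; refining a decomposition can only increase the sum of
    the [rabs M (T x)]. *)
Lemma vtotal_split xs x y : vall_pos xs -> 0 <<= x -> 0 <<= y -> vtotal xs = x + y ->
  exists ys zs, [/\ vall_pos ys, vall_pos zs, vtotal ys = x, vtotal zs = y
    & abs_total xs <<< abs_total ys + abs_total zs].
Proof.
elim: xs x y => [|v xs IH] x y /=.
  move=> _ x0 y0 e.
  have ex : x = 0.
    apply: (@rle_anti _ _ L) => //; rewrite e.
    by apply: (rle_by1 y0); mring.
  have ey : y = 0 by rewrite e ex add0r.
  exists [::], [::]; split=> //=; rewrite addr0; exact: rle_refl.
move=> [v0 xs0] x0 y0 e.
have vle : v <<= x + y by rewrite -e; apply: (rle_by1 (vtotal_ge0 xs0)); mring.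
have [a [b [vab a0 ax b0 b_y]]] := riesz_dec v0 vle x0 y0.
have [|||ys [zs [ys0 zs0 eys ezs h]]] := IH (x - a) (y - b) xs0.
- exact: (rle_subl _ _ _).1.
- exact: (rle_subl _ _ _).1.
- have -> : vtotal xs = (v + vtotal xs) - v by mring.
  by rewrite e vab; mring.
exists (a :: ys), (b :: zs); split=> //=.
- by rewrite eys; mring.
- by rewrite ezs; mring.
- have hv : rabs M (T v) <<< rabs M (T a) + rabs M (T b).
    by rewrite vab linopD; apply: rabsD.
  by apply: (rle_by2 hv h); mringW.
Qed.

(** A substitute for [f] composed with the modulus of [T], which need not exist as an operator: the
    supremum of [f (abs_total xs)] over the finite positive decompositions [xs] of [x]. Order
    boundedness makes it finite; splitting and concatenation make it additive. *)
Lemma dominating_functional f : lin f -> posf M f ->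
  exists phi, [/\ lin phi, posf L phi & forall x, 0 <<= x -> f (rabs M (T x)) <= phi x].
Proof.
move=> lf pf.
pose S x := [set r | exists xs, [/\ vall_pos xs, vtotal xs = x & r = f (abs_total xs)]].
pose p x := sup (S x).
have ge x xs : vall_pos xs -> vtotal xs = x -> f (abs_total xs) <= p x.
  move=> xs0 e; have [w hw] := oT x.
  apply: (@le_sup_of _ _ (f w)); last by exists xs.
  move=> r [ys [ys0 eys ->]]; apply: (posf_le lf pf).
  rewrite -[abs_total ys]add0r; apply: abs_total_le => // y; rewrite eys add0r => /hw.
  by apply: rle_trans; apply: rabs_ge.
have single x : 0 <<= x -> S x (f (abs_total [:: x])).
  by move=> x0; exists [:: x]; split=> //=; rewrite addr0.
have le x b : 0 <<= x ->
    (forall xs, vall_pos xs -> vtotal xs = x -> f (abs_total xs) <= b) -> p x <= b.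
  by move=> x0 h; apply: (sup_le_of (single x x0)) => r [xs [? ? ->]]; apply: h.
have hge x : 0 <<= x -> f (rabs M (T x)) <= p x.
  move=> x0; have := ge x [:: x]; rewrite /= !addr0; exact.
have p0 x : 0 <<= x -> 0 <= p x.
  by move=> x0; apply: le_trans (hge x x0); apply: pf; apply: rabs_ge0.
have pD x y : 0 <<= x -> 0 <<= y -> p (x + y) = p x + p y.
  move=> x0 y0; apply/eqP; rewrite eq_le; apply/andP; split.
    apply: (le) => [|xs xs0 e]; first exact: radd_ge0.
    have [ys [zs [ys0 zs0 eys ezs h]]] := vtotal_split xs0 x0 y0 e.
    apply: le_trans (posf_le lf pf h) _; rewrite (linD lf).
    by apply: lerD; apply: ge.
  rewrite -lerBrDr; apply: (le) => // ys ys0 eys.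
  rewrite lerBrDl -lerBrDr; apply: (le) => // zs zs0 ezs.
  rewrite lerBrDl -(linD lf) -abs_total_cat; apply: ge.
    exact: vall_pos_cat.
  by rewrite vtotal_cat eys ezs.
exists (pext L p); split; [exact: pext_lin|exact: pext_pos|].
by move=> x x0; rewrite pext_cone //; apply: hge.
Qed.

Lemma abs_image_null f (x : nat -> V) : lin f -> posf M f ->
  wnull L x -> (forall n, 0 <<= x n) -> null (fun n => f (rabs M (T (x n)))).
Proof.
move=> lf pf wx x0; have [phi [lphi pphi h]] := dominating_functional lf pf.
apply: (null_le (wx phi (posf_bdd lphi pphi))) => n.
rewrite ger0_norm; first exact: h.
by apply: pf; apply: rabs_ge0.
Qed.

Hypothesis awdp : forall (x : nat -> V) (f : nat -> dual M),
  disj_seq L x -> wnull L x -> disj_seq (dual_nlat M) f -> wnull (dual_nlat M) f ->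
  null (fun n => f n (T (x n))).

Hypothesis wnull_nbdd : forall x, wnull L x -> nbounded L x.

(** The disjoint test in the domain, for the functionals [f n] composed with [T] and dominated by
    their moduli. *)
Lemma subseq_test (x : nat -> V) (f : nat -> dual M) : wnull L x ->
  (forall w, 0 <<< w -> null (fun n => dabs M (f n) w)) ->
  (forall s h, str_incr s -> disj_seq L h -> wnull L h ->
     (forall j, rabs L (h j) <<= rabs L (x (s j))) ->
     null (fun j => f (s j) (T (h j)))) ->
  null (fun n => f n (T (x n))).
Proof.
move=> wx nf test.
have bc n := comp_bdd (dualP (f n)).
apply: (@disjoint_test _ _ L x (fun n y => f n (T y))
  (fun n => dabs L (fun y => f n (T y)))) => //.
- exact: wnull_nbdd.
- by move=> n; apply: (bc n).1.
- by move=> n; apply: dabs_lin.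
- by move=> n; apply: dabs_posf.
- by move=> n k; apply: (dabs_ge (bc n)); apply: rle_refl.
- by apply: (@dabs_comp_null (fun n => dfun (f n))) => // n; apply: dualP.
Qed.

Lemma wnull_subseq (U : lmodType R) (K : nlat U) (x : nat -> U) s :
  str_incr s -> wnull K x -> wnull K (fun n => x (s n)).
Proof. by move=> hs wx f bf; apply: (null_subseq hs (wx f bf)). Qed.

Lemma disj_subseq (U : lmodType R) (K : nlat U) (x : nat -> U) s :
  str_incr s -> disj_seq K x -> disj_seq K (fun n => x (s n)).
Proof. by move=> hs dx i j ij; apply: dx; apply: str_incr_inj. Qed.

(** The moduli of a disjoint weakly null sequence are weakly null by solidity, so they vanish
    pointwise in the limit and the test in the domain applies. *)
Lemma awdp_disj_dual (x : nat -> V) (f : nat -> dual M) :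
  wnull L x -> disj_seq (dual_nlat M) f -> wnull (dual_nlat M) f ->
  null (fun n => f n (T (x n))).
Proof.
move=> wx df wf; apply: subseq_test => // [w w0|s h hs dh wh _].
  have : wnull (dual_nlat M) (fun n => rabs (dual_nlat M) (f n)).
    apply: (disj_solid_wnull wf) => [i j ij|n]; rewrite !rabsK; first exact: df.
    exact: rle_refl.
  move=> /(_ _ (eval_bdd M w)); congr null; apply/funext => n.
  by rewrite dual_rabsE.
by apply: awdp => //; [apply: disj_subseq|apply: wnull_subseq].
Qed.

(** Here the test takes place in the dual of the codomain, for evaluations at [T (x n)] dominated by
    evaluations at [rabs M (T (x n))]. Positivity of the [x n] makes the latter tend to zero, by
    [abs_image_null]. *)
Lemma awdp_pos (x : nat -> V) (f : nat -> dual M) :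
  wnull L x -> (forall n, 0 <<= x n) -> wnull (dual_nlat M) f ->
  null (fun n => f n (T (x n))).
Proof.
move=> wx x0 wf.
apply: (@disjoint_test _ _ (dual_nlat M) f (fun n g => g (T (x n)))
   (fun n g => g (rabs M (T (x n))))) => //.
- exact: dual_wnull_nbounded.
- by move=> n g g0; apply: (g0 _ (rabs_ge0 _ _)).
- move=> n g; rewrite dual_rabsE; apply: (dabs_ge (dualP g)); exact: rle_refl.
- move=> g g0; apply: abs_image_null => //; exact: (dualP g).1.
- move=> s h hs dh wh _; apply: awdp_disj_dual => //; exact: wnull_subseq.
Qed.

Lemma awdp_pos_neg (x : nat -> V) (f : nat -> dual M) :
  wnull L (fun n => rpos L (x n)) -> wnull L (fun n => rpos L (- x n)) ->
  wnull (dual_nlat M) f -> null (fun n => f n (T (x n))).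
Proof.
move=> w1 w2 wf.
have n1 := awdp_pos w1 (fun n => rpos_ge0 L _) wf.
have n2 := nullZ (-1) (awdp_pos w2 (fun n => rpos_ge0 L _) wf).
have := nullD n1 n2; congr null; apply/funext => n /=.
by rewrite [in RHS](rposB L (x n)) linopD linopN (linB (dualP (f n)).1) mulN1r.
Qed.

Lemma awdp_dual_abs_null (x : nat -> V) (f : nat -> dual M) :
  (forall w, 0 <<< w -> null (fun n => dabs M (f n) w)) ->
  wnull L x -> wnull (dual_nlat M) f -> null (fun n => f n (T (x n))).
Proof.
move=> nf wx wf; apply: subseq_test => // s h hs dh wh _.
have wpart (g : nat -> V) : (forall n, 0 <<= g n) ->
    (forall n, g n <<= rabs L (h n)) -> wnull L g.
  move=> g0 gh; apply: (disj_solid_wnull wh) => [i j ij|n]; rewrite !(rabs_id (g0 _)) //.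
  exact: (rdisj_le (dh i j ij)).
have w1 : wnull L (fun n => rpos L (h n)).
  by apply: wpart => n; [exact: rpos_ge0|exact: rpos_le_abs].
have w2 : wnull L (fun n => rpos L (- h n)).
  by apply: wpart => n; [exact: rpos_ge0|exact: rneg_le_abs].
exact: (awdp_pos_neg w1 w2 (wnull_subseq hs wf)).
Qed.

End OrderBounded.

(** * Discrete lattices with order continuous norm *)

Section Discrete.
Variables (R : realType) (F : completeNormedModType R) (LF : banach_lattice_on F).
Let L := bl_nlat LF.

Local Notation "x <<= y" := (rle L x y) (at level 70, no associativity).
Local Ltac mring := lazymatch goal with |- ?a = ?b => lmod_of R F a b end.

(** The two parts of [y - t *: d] are disjoint and below [d], so one vanishes: [y] is comparable
    with every [t *: d]. The coefficient is the supremum of the [t] with [t *: d <<= y]. *)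
Lemma discrete_elt_interval d y : discrete_elt LF d -> 0 <<= y -> y <<= d ->
  exists2 t : R, 0 <= t <= 1 & y = t *: d.
Proof.
move=> [d0 [dn0 hd]] y0 yd.
have cmp t : 0 <= t <= 1 -> t *: d <<= y \/ y <<= t *: d.
  move=> /andP[t0 t1].
  have td0 : 0 <<= t *: d by apply: rscale_ge0.
  have td1 : t *: d <<= d by rewrite -[X in _ <<= X]scale1r; apply: rscale_le.
  have le1 : rpos L (y - t *: d) <<= d.
    by apply: rjoin_lub => //; apply: (rle_by2 yd td0); mring.
  have le2 : rpos L (- (y - t *: d)) <<= d.
    by apply: rjoin_lub => //; apply: (rle_by2 td1 y0); mring.
  have [h|h] := hd _ _ (rpos_ge0 L _) le1 (rpos_ge0 L _) le2 (rpos_disj L _).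
    right; have := rpos_ge L (y - t *: d); rewrite h => h'.
    by apply: (rle_by1 h'); mring.
  left; have := rpos_ge L (- (y - t *: d)); rewrite h => h'.
  by apply: (rle_by1 h'); mring.
pose S := [set t : R | 0 <= t <= 1 /\ t *: d <<= y].
have S0 : S 0 by rewrite /S /= scale0r lexx ler01.
have Sub t : S t -> t <= 1 by move=> [/andP[]].
have hS : has_sup S by split; [exists 0|exists 1].
pose m := sup S.
have m0 : 0 <= m by apply: (le_sup_of Sub).
have m1 : m <= 1 by apply: (sup_le_of S0).
have up e : 0 < e -> y <<= (m + e) *: d.
  move=> e0; case: (leP (m + e) 1) => [me|me]; last first.
    apply: rle_trans yd _; rewrite -[X in X <<= _]scale1r.
    by apply: rscale_le => //; apply: ltW.
  have me01 : 0 <= m + e <= 1 by rewrite me andbT addr_ge0 // ltW.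
  have [h|//] := cmp _ me01.
  have : m + e <= m by apply: (le_sup_of Sub).
  lra.
have dn e : 0 < e -> (m - e) *: d <<= y.
  move=> e0; have [t [_ ty] mt] := sup_adherent e0 hS.
  by apply: rle_trans ty; apply: rscale_le => //; apply: ltW.
exists m; first by rewrite m0.
have ar z : (forall e, 0 < e -> z <<= e *: d) -> z <<= 0.
  move=> h; apply: (@rarchi _ _ L _ d) => -[|n]; first by rewrite scale0r.
  have n0 : 0 < n.+1%:R :> R by rewrite ltr0n.
  have := rle_scale (ltW n0) (h n.+1%:R^-1 ltac:(by rewrite invr_gt0)).
  by rewrite scalerA divff ?gt_eqF // scale1r.
apply: (@rle_anti _ _ L).
  suff h : y - m *: d <<= 0 by apply: (rle_by1 h); mring.
  by apply: ar => e /up h; apply: (rle_by1 h); mring.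
suff h : m *: d - y <<= 0 by apply: (rle_by1 h); mring.
by apply: ar => e /dn h; apply: (rle_by1 h); mring.
Qed.

Fixpoint in_box (ds : seq (R * F)) (y : F) : Prop :=
  if ds is d :: ds' then
    exists (t : R) (z : F), [/\ `|t| <= d.1, in_box ds' z & y = t *: d.2 + z]
  else y = 0.

Fixpoint box_norm (ds : seq (R * F)) (f : F -> R) : R :=
  if ds is d :: ds' then d.1 * `|f d.2| + box_norm ds' f else 0.

Lemma in_box_cat ds es y z : in_box ds y -> in_box es z -> in_box (ds ++ es) (y + z).
Proof.
elim: ds y => [|d ds IH] y /=; first by move=> ->; rewrite add0r.
move=> [t [v [ht hv ->]]] hz; exists t, (v + z); split=> //; first exact: IH.
by rewrite addrA.
Qed.

Lemma in_box_le ds y f : lin f -> in_box ds y -> `|f y| <= box_norm ds f.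
Proof.
move=> lf; elim: ds y => [|d ds IH] y /=; first by move=> ->; rewrite (lin0 lf) normr0.
move=> [t [z [ht /IH hz ->]]]; rewrite (linD lf) (linZ lf).
apply: le_trans (ler_normD _ _) (lerD _ hz); rewrite normrM.
exact: ler_wpM2r.
Qed.

Lemma box_norm_null ds (f : nat -> F -> R) : (forall x, null (fun n => f n x)) ->
  null (fun n => box_norm ds (f n)).
Proof.
move=> h; elim: ds => [|d ds IH] /=; first exact: null0.
apply: nullD => //; apply: nullZ; move=> e /(h d.2)[N hN].
by exists N => n /hN; rewrite normr_id.
Qed.

(* [0, v] lies in a bounded part of a finite-dimensional subspace *)
Definition fin_box v := exists ds, forall y, 0 <<= y -> y <<= v -> in_box ds y.

Lemma fin_box_add v w : 0 <<= v -> 0 <<= w -> fin_box v -> fin_box w -> fin_box (v + w).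
Proof.
move=> v0 w0 [ds hds] [es hes]; exists (ds ++ es) => y y0 yvw.
have [y1 [y2 [-> ? ? ? ?]]] := riesz_dec y0 yvw v0 w0.
by apply: in_box_cat; [apply: hds|apply: hes].
Qed.

Lemma fin_box_le v w : v <<= w -> fin_box w -> fin_box v.
Proof.
by move=> vw [ds hds]; exists ds => y y0 yv; apply: hds => //; apply: rle_trans vw.
Qed.

Lemma fin_box0 : fin_box 0.
Proof. by exists [::] => y y0 y0'; apply: (@rle_anti _ _ L). Qed.

Lemma fin_box_discrete d : discrete_elt LF d -> fin_box d.
Proof.
move=> hd; exists [:: (1, d)] => y y0 yd /=.
have [t /andP[t0 t1] ->] := discrete_elt_interval hd y0 yd.
by exists t, 0; split=> //; rewrite ?addr0 // ger0_norm.
Qed.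

(** Order continuity is applied to the net [u - v], where [v] runs upwards through the vectors
    between [0] and [u] that satisfy [fin_box]. *)
Lemma fin_box_approx u (e : R) : discrete_lattice LF -> order_continuous_norm LF ->
  0 <<= u -> 0 < e -> exists v, [/\ fin_box v, 0 <<= v, v <<= u & `|u - v| < e].
Proof.
move=> hdis hoc u0 e0.
pose I := {v | [/\ fin_box v, 0 <<= v & v <<= u]}.
have I0 : [/\ fin_box 0, 0 <<= 0 & 0 <<= u].
  by split=> //; [apply: fin_box0|apply: rle_refl].
have [|||||||[v [h1 h2 h3]] hv] :=
  hoc I (fun v w => sval v <<= sval w) (fun v => u - sval v) _ _ _ _ _ _ _ e e0.
- by exists (exist _ 0 I0).
- by move=> v; apply: rle_refl.
- by move=> v w z; apply: rle_trans.
- move=> [v [v1 v2 v3]] [w [w1 w2 w3]].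
  have jP : [/\ fin_box (rjoin L v w), 0 <<= rjoin L v w & rjoin L v w <<= u].
    split; [|exact: rle_trans v2 (rjoin_ubl _ _ _)|exact: rjoin_lub].
    apply: fin_box_le (fin_box_add v2 w2 v1 w1); apply: rjoin_lub.
      by apply: (rle_by1 w2); mring.
    by apply: (rle_by1 v2); mring.
  by exists (exist _ (rjoin L v w) jP); split;
    [exact: (rjoin_ubl L v w)|exact: (rjoin_ubr L v w)].
- by move=> v w vw; change (u - sval w <<= u - sval v); apply: (rle_by1 vw); mring.
- by move=> [v [v1 v2 v3]] /=; change (0 <<= u - v); apply: (rle_subl _ _ _).1.
- move=> z hz; apply: contrapT => nz.
  have pz : rpos L z <> 0.
    by move=> h; apply: nz; have := rpos_ge L z; rewrite h.
  have [d [d0 [dz hd]]] := hdis _ (rpos_ge0 L z) pz.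
  (* If [n d] is an index of the net, then [d] lies below [u - n d], so [(n + 1) d] is one too. All
     multiples of [d] then stay below [u], contradicting the Archimedean property. *)
  have key n : [/\ fin_box (n%:R *: d), 0 <<= n%:R *: d & n%:R *: d <<= u].
    elim: n => [|n [IH1 IH2 IH3]]; first by rewrite scale0r.
    rewrite -natr1 scalerDl scale1r; split.
    - by apply: fin_box_add => //; apply: fin_box_discrete.
    - exact: radd_ge0.
    - have h : rpos L z <<= u - n%:R *: d.
        apply: rjoin_lub; last exact: (rle_subl _ _ _).1.
        exact: (hz (exist _ (n%:R *: d) (And3 IH1 IH2 IH3))).
      by apply: (rle_by2 h dz); mring.
  have dle : d <<= 0 by apply: (@rarchi _ _ L _ u) => n; have [] := key n.
  by have [_ [] dn _] := hd; apply: dn; apply: (@rle_anti _ _ L).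
by exists v; split=> //; apply: (hv (exist _ v (And3 h1 h2 h3))); apply: rle_refl.
Qed.

Lemma discrete_dabs_null (f : nat -> dual L) :
  discrete_lattice LF -> order_continuous_norm LF ->
  wnull (dual_nlat L) f -> forall u, 0 <<= u -> null (fun n => dabs L (f n) u).
Proof.
move=> hdis hoc wf u u0 e e0.
have ptw x : null (fun n => f n x) := wf _ (eval_bdd L x).
have [C hC] := dual_wnull_nbounded wf.
have C0 : 0 <= C by have [] := hC 0%N.
have C1 : 0 < 4 * (C + 1) by lra.
(* On the box the [f n] are uniformly small; on the rest, of norm below [e / (4 * (C + 1))], the
   bound [C] gives [e / 4]. Both parts of [y] thus contribute at most [e / 2]. *)
have [v [[ds hds] v0 vu huv]] := fin_box_approx hdis hoc u0 (divr_gt0 e0 C1).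
have e4 : 0 < e / 4 by lra.
have [N hN] := box_norm_null ds ptw e4.
exists N => n /hN hn; have bf := dualP (f n); have lf := bf.1.
have Ce : C * (e / (4 * (C + 1))) <= e / 4.
  have C1' : 0 < C + 1 by lra.
  have -> : C * (e / (4 * (C + 1))) = e / 4 * (C / (C + 1)).
    by field; rewrite gt_eqF.
  by apply: ler_piMr; [apply: ltW|rewrite ler_pdivrMr //; lra].
have half y : 0 <<= y -> y <<= u -> `|f n y| <= e / 2.
  move=> y0 yu.
  have uv0 : 0 <<= u - v by apply: (rle_subl _ _ _).1.
  have yuv : y <<= v + (u - v) by apply: (rle_by1 yu); mring.
  have [y1 [y2 [-> y10 y1v y20 y2uv]]] := riesz_dec y0 yuv v0 uv0.
  rewrite (linD lf); apply: le_trans (ler_normD _ _) _.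
  have h1 := le_trans (in_box_le lf (hds _ y10 y1v)) (le_trans (ler_norm _) hn).
  have h2 : `|f n y2| <= C * (e / (4 * (C + 1))).
    have [_] := hC n; apply.
    apply: (@nbd_mono _ _ L _ (u - v)); last exact: ltW.
    by rewrite !rabs_id.
  lra.
rewrite ger0_norm; last exact: dabs_posf.
apply: (dabs_le bf) => // y hy; rewrite (rposB L y) (linB lf).
apply: le_trans (ler_normB _ _) _.
have h1 := half _ (rpos_ge0 L y) (rle_trans (rpos_le_abs L y) hy).
have h2 := half _ (rpos_ge0 L (- y)) (rle_trans (rneg_le_abs L y) hy).
lra.
Qed.

End Discrete.

(** * Weak convergence and disjointness in the dual, translated *)

Section DualTranslation.
Variables (R : realType) (F : completeNormedModType R) (LF : banach_lattice_on F).
Let L := bl_nlat LF.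

Lemma dual_weakly_nullP (f : nat -> dual L) :
  dual_weakly_null (fun n => dfun (f n)) <-> wnull (dual_nlat L) f.
Proof.
split=> [[_ h] Phi bPhi|h].
  (* [in_bidual] speaks of maps on all functions, so [Phi] is extended by zero off the bounded
     functionals. *)
  pose phi (g : F -> R) := if pselect (bdd L g) is left bg then Phi (Dual bg) else 0.
  have phiE g (bg : bdd L g) : phi g = Phi (Dual bg).
    by rewrite /phi; case: pselect => // bg'; congr Phi; apply: dual_ext.
  have bphi : in_bidual phi.
    split=> [a g k /(in_dualP LF) bg /(in_dualP LF) bk|].
      rewrite (phiE _ bg) (phiE _ bk) (phiE _ (bdd_comb a bg bk)) -bPhi.1.
      by congr Phi; apply: dual_ext.
    have [_ [C hC]] := bPhi; exists C => g M /(in_dualP LF) bg M0 hg.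
    rewrite (phiE _ bg); apply: hC; split=> // x K hK.
    by apply: le_trans (hg x) _; apply: ler_wpM2l.
  have /nullP := h _ bphi; congr null; apply/funext => n.
  by rewrite (phiE _ (dualP (f n))); congr Phi; apply: dual_ext.
split=> [n|phi [lphi [C hC]]]; first exact/(in_dualP LF)/dualP.
apply/nullP; apply: (h (fun g => phi (dfun g))); split.
  by move=> a g k; apply: lphi; apply/(in_dualP LF)/dualP.
exists C => g M [M0 hM]; apply: hC => // [|y]; first exact/(in_dualP LF)/dualP.
exact: (hM y `|y| (lexx _)).
Qed.

Lemma dual_disjointP (f g : dual L) :
  rmeet (dual_nlat L) (rabs (dual_nlat L) f) (rabs (dual_nlat L) g) = 0 ->
  dual_disjoint LF f g.
Proof.
rewrite !dual_rabs; set P := dual_modulus f; set Q := dual_modulus g => h x x0.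
have pP := dabs_posf (dualP f); have pQ := dabs_posf (dualP g).
have lP : lin P := (dualP P).1; have lQ : lin Q := (dualP Q).1.
pose D : dual L := - P - - Q.
have hD : dabs L D x = P x + Q x.
  have : dual_join (- P) (- Q) x = 0.
    have h' : - dual_join (- P) (- Q) = 0 := h.
    by move: h' => /eqP; rewrite oppr_eq0 => /eqP ->.
  by rewrite dual_joinE !dualNE -/D; lra.
pose S := [set r | exists y, ble LF 0 y /\ ble LF y x /\
                   r = dual_abs LF f y + dual_abs LF g (x - y)].
have S_ge0 r : S r -> 0 <= r.
  by move=> [y [y0 [yx ->]]]; apply: addr_ge0;
    [apply: pP|apply: pQ; apply: (rle_subl L _ _).1].
have small e : 0 < e -> exists2 r, S r & r <= e.
  move=> e0.
  have [y hy he] : exists2 y, rle L (rabs L y) x & P x + Q x - e <= Q y - P y.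
    apply: contrapT => hno.
    have : dabs L D x <= dabs L D x - e; last by lra.
    apply: (dabs_le (dualP D)) => // y hy; rewrite hD.
    have hDy : D y = Q y - P y by rewrite dualDE !dualNE; lra.
    have key z : rle L (rabs L z) x -> Q z - P z <= P x + Q x - e.
      move=> hz; rewrite leNgt; apply/negP => hlt; apply: hno; exists z => //.
      exact: ltW.
    have := key y hy; have := key (- y); rewrite rabsN => /(_ hy).
    rewrite (linN lP) (linN lQ) hDy ler_norml => h1 h2.
    by apply/andP; split; lra.
  have /rabs_leP[y1 y2] := hy.
  (* If [y] almost attains the modulus of [D] at [x], this midpoint lies between [0] and [x], and
     [P z + Q (x - z)] is half the defect. *)
  pose z : F := 2^-1 *: (x + y).
  have xz : x - z = 2^-1 *: (x - y).
    by rewrite /z; lmod_of R F (x - 2^-1 *: (x + y)) (2^-1 *: (x - y)).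
  have hf : 0 <= 2^-1 :> R by rewrite invr_ge0.
  have z0 : rle L 0 z.
    by apply: rscale_ge0 => //; apply: (rle_by1 y2); lmod_of R F (x + y - 0) (x - - y).
  have z1 : rle L 0 (x - z) by rewrite xz; apply: rscale_ge0 => //; apply: (rle_subl _ _ _).1.
  exists (P z + Q (x - z)).
    by exists z; split=> //; split=> //; apply: (rle_subl L _ _).2.
  by rewrite xz /z (linZ lP) (linZ lQ) (linD lP) (linB lQ); lra.
apply/eqP; rewrite eq_le; apply/andP; split.
  apply/ler_addgt0Pr => e e0; have [r Sr re] := small e e0; rewrite add0r.
  apply: le_trans re; apply: ge_inf => //; by exists 0.
apply: lb_le_inf => [|r]; last exact: S_ge0.
by have [r Sr _] := small 1 ltr01; exists r.
Qed.

End DualTranslation.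

(** * Almost weak Dunford-Pettis against weak Dunford-Pettis operators *)

Theorem theoremA (R : realType) (E F : completeNormedModType R)
  (LE : banach_lattice_on E) (LF : banach_lattice_on F) (T : E -> F) :
  bounded_operator T ->
  order_bounded LE LF T ->
  (swc_lattice_ops LE \/
   dual_swc_lattice_ops LF \/
   (positive_op LE LF T /\ discrete_lattice LF /\ order_continuous_norm LF)) ->
  (awDP LE LF T <-> wDP T).
Proof.
move=> [lT _] obT cases; split; last first.
  by move=> h x f _ wx _ wf; apply: h.
move=> aw x f wx wf.
pose L := bl_nlat LE; pose M := bl_nlat LF.
have oT : obop L M T.
  move=> u; have [c [d hcd]] := obT (- u) u.
  exists (rabs M c + rabs M d) => y /rabs_leP[y1 y2].
  have [|h1 h2] := hcd y _ y1.
    by apply: (rle_by1 (L := L) y2); rewrite opprK addrC opprK.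
  have hc := rabs_ge0 M c; have hd := rabs_ge0 M d.
  have hc' := rabs_geN M c; have hd' := rabs_ge M d.
  apply/rabs_leP; split.
    apply: (rle_by3 (L := M) h2 hd' hc); set b1 := rabs M c; set b2 := rabs M d.
    by lmod_of R F (b1 + b2 - T y) (d - T y + (b2 - d) + (b1 - 0)).
  apply: (rle_by3 (L := M) h1 hc' hd); set b1 := rabs M c; set b2 := rabs M d.
  by lmod_of R F (b1 + b2 - - T y) (T y - c + (b1 - - c) + (b2 - 0)).
have awd (y : nat -> E) (g : nat -> dual M) : disj_seq L y -> wnull L y ->
    disj_seq (dual_nlat M) g -> wnull (dual_nlat M) g -> null (fun n => g n (T (y n))).
  move=> dy wy dg wg; apply/nullP; apply: (aw y (fun n => dfun (g n))) => //.
  - exact/(weakly_nullP LE).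
  - by move=> n m nm; apply: dual_disjointP; apply: dg.
  - exact/dual_weakly_nullP.
pose fd n : dual M := Dual ((in_dualP LF (f n)).1 (wf.1 n)).
have wfd : wnull (dual_nlat M) fd by apply/dual_weakly_nullP.
have wxL : wnull L x by apply/weakly_nullP.
have bE := @wnull_nbounded _ _ LE.
apply/nullP; change (null (fun n => fd n (T (x n)))).
case: cases => [swc|[swc|[_ [dis oc]]]].
(* Case (i): the parts of [x n] are half of [rabs L (x n)] plus or minus [x n], hence weakly
   null. *)
- have wabs : wnull L (fun n => rabs L (x n)) by apply/weakly_nullP/swc.
  have part (s : R) (p : nat -> E) : (forall n, p n = 2^-1 *: (s *: x n + rabs L (x n))) ->
      wnull L p.
    move=> hp phi bphi.
    have := nullZ 2^-1 (nullD (nullZ s (wxL phi bphi)) (wabs phi bphi)).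
    by congr null; apply/funext => n; rewrite hp (linZ bphi.1) bphi.1.
  apply: (awdp_pos_neg lT oT awd bE _ _ wfd).
    apply: (part 1) => n; rewrite rabsE rposN.
    set p := rpos L (x n).
    by lmod_of R E p (2^-1 *: (1 *: x n + (p + (p - x n)))).
  apply: (part (-1)) => n; rewrite rabsE rposN.
  set p := rpos L (x n).
  by lmod_of R E (p - x n) (2^-1 *: ((-1) *: x n + (p + (p - x n)))).
(* Case (ii): the moduli of the [f n] are weakly null, in particular when evaluated at [w]. *)
- apply: (awdp_dual_abs_null lT oT awd bE) => // w w0.
  have wabs : wnull (dual_nlat M) (fun n => dual_modulus (fd n)).
    by apply/dual_weakly_nullP; apply: (swc f).
  exact: (wabs _ (eval_bdd M w)).
(* Case (iii): pointwise convergence of the moduli comes from the approximation of order intervals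
   by boxes. *)
- apply: (awdp_dual_abs_null lT oT awd bE) => //.
  exact: discrete_dabs_null.
Qed.
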